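(* Let $n\ge3$. The orbit space $\mathcal{R}=T^*\mathrm{S}^{n-1}/\mathrm{O}(n-1)$ (equivalently $D/G$) of the $n$-dimensional axisymmetric Veselova top is a stratified semi-algebraic subspace of $\mathbb{R}^3$ given, via the invariants $(q_1,p_1,P)$ with $P=\|p\|^2$, by $$\mathcal{R}=\{(q_1,p_1,P)\in\mathbb{R}^3:\ p_1^2\le(1-q_1^2)P,\ -1\le q_1\le1,\ P\ge0\}.$$
   Context: $T^*\mathrm{S}^{n-1}=\{(q,p)\in\mathbb{R}^n\times\mathbb{R}^n:\|q\|=1,\ q\cdot p=0\}$. Write $q=(q_1,q_2)$, $p=(p_1,p_2)\in\mathbb{R}\times\mathbb{R}^{n-1}$. $G_R=\mathrm{O}(n-1)$ acts by $h\cdot(q_1,q_2,p_1,p_2)=(q_1,hq_2,p_1,hp_2)$. The orbit space is identified with its image in $\mathbb{R}^3$ under the map induced by the invariants $(q,p)\mapsto(q_1,p_1,P)$, $P=\|p\|^2$. $D$ is the phase space of the unreduced system: $D=\{(g,\Omega)\in\mathrm{O}(n)\times\mathfrak{so}(n):\Omega=q\wedge v\text{ for some }v\in\mathbb{R}^n,\ q=g^{-1}e_1\}$, where $a\wedge b=ab^T-ba^T$ and $e_1$ is the first standard basis vector. The mass tensor is $\mathbb{J}=\mathrm{diag}[J_1,J_2,\dots,J_2]$ with $J_1,J_2>0$, $J_1\ne J_2$, and $\mathbb{I}(\Omega)=\mathbb{J}\Omega+\Omega\mathbb{J}$. $G=G_L\times G_R$, where $G_L\cong\mathrm{O}(n-1)$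 is the subgroup of $\mathrm{O}(n)$ fixing $e_1$ and $G_R\cong\mathrm{O}(n-1)$ is the group of $h\in\mathrm{O}(n)$ fixing the first body axis, acting by $(A,B)\cdot(g,\Omega)=(AgB^{-1},B\Omega B^{-1})$; $D/G_L$ is identified with $T^*\mathrm{S}^{n-1}$ by $(g,\Omega)\mapsto(g^{-1}e_1,-\mathbb{I}(\Omega)g^{-1}e_1)$. ''Stratified'' refers to the stratification of the orbit space by orbit types. *)

(* Defs.v *)
From HB Require Import structures.
From mathcomp Require Import all_boot all_order all_algebra.
From mathcomp Require Import all_classical all_reals all_analysis.
(* Not imported: the notations of mpoly clash with those of the analysis
   library. *)
From mathcomp Require mpoly.

Set Implicit Arguments.
Unset Strict Implicit.
Unset Printing Implicit Defensive.

Import Order.TTheory GRing.Theory Num.Theory.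
Import numFieldNormedType.Exports.

Local Open Scope classical_set_scope.
Local Open Scope quotient_scope.
Local Open Scope ring_scope.

Record action (G : groupType) (X : Type) := Action {
  act :> G -> X -> X;
  act1g : forall x, act 1%g x = x;
  actMg : forall g h x, act (g * h)%g x = act g (act h x) }.

Section OrbitSpace.
Variables (G : groupType) (X : topologicalType) (a : action G X).

Definition orbit_rel (x y : X) : bool := `[< exists g, a g x = y >].

Fact orbit_rel_refl : reflexive orbit_rel.
Proof. by move=> x; apply/asboolP; exists 1%g; rewrite act1g. Qed.

Fact orbit_rel_sym : symmetric orbit_rel.
Proof.
suff H x y : orbit_rel x y -> orbit_rel y x by move=> x y; apply/idP/idP; exact: H.
move=> /asboolP[g <-]; apply/asboolP; exists g^-1%g.
by rewrite -actMg mulVg act1g.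
Qed.

Fact orbit_rel_trans : transitive orbit_rel.
Proof.
move=> y x z /asboolP[g <-] /asboolP[h <-]; apply/asboolP; exists (h * g)%g.
by rewrite actMg.
Qed.

Definition orbit_equiv :=
  EquivRel orbit_rel orbit_rel_refl orbit_rel_sym orbit_rel_trans.

Definition orbit_space := quotient_topology {eq_quot orbit_equiv}.

Definition orbit_proj (x : X) : orbit_space := \pi_{eq_quot orbit_equiv} x.

Definition isotropy (x : X) : set G := [set g | a g x = x].

Definition same_orbit_type (x y : X) : Prop :=
  exists k : G, isotropy y = [set (h ^ k)%g | h in isotropy x].

Definition orbit_type_strata : set (set orbit_space) :=
  [set orbit_proj @` [set y | same_orbit_type x y] | x in [set: X]].

End OrbitSpace.

Arguments orbit_type_strata {G X} a _.

Definition homeomorphism_onto (X Y : topologicalType) (f : X -> Y) (A : set Y) :=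
  [/\ continuous f, injective f, range f = A &
      forall U : set X, open U ->
        exists2 V : set Y, open V & f @` U = A `&` V].

Section Euclidean.
Variables (R : realType) (n : nat).
Implicit Types (A S T U : set 'rV[R]_n).

Inductive semialgebraic : set 'rV[R]_n -> Prop :=
| semialgebraic_pos (f : mpoly.mpoly n R) :
    semialgebraic [set x | 0 < mpoly.meval (fun i => x 0 i) f]
| semialgebraicC A : semialgebraic A -> semialgebraic (~` A)
| semialgebraicI A B :
    semialgebraic A -> semialgebraic B -> semialgebraic (A `&` B)
| semialgebraicU A B :
    semialgebraic A -> semialgebraic B -> semialgebraic (A `|` B).

Definition iter_partial (V : normedModType R) (s : seq 'I_n)
    (f : 'rV[R]_n -> V) : 'rV[R]_n -> V :=
  foldr (fun j (g : 'rV[R]_n -> V) x => 'D_(delta_mx 0 j) g x) f s.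

(* C^infinity, provided that U is open. *)
Definition smooth_on (V : normedModType R) U (f : 'rV[R]_n -> V) : Prop :=
  forall (s : seq 'I_n) (x : 'rV[R]_n), U x ->
    {for x, continuous (iter_partial s f)} /\
    forall j, derivable (iter_partial s f) x (delta_mx 0 j).

(* A k-dimensional embedded C^infinity submanifold of R^n: locally the zero
   set of c = n - k smooth functions with independent differentials. *)
Definition submanifold (k : nat) S : Prop :=
  forall x, S x ->
    exists (c : nat) (U : set 'rV[R]_n) (F : 'rV[R]_n -> 'rV[R]_c),
      [/\ (c + k = n)%N, open U /\ U x, smooth_on U F,
          forall y, U y -> \rank ('J F y) = c &
          S `&` U = [set y | U y /\ F y = 0]].

Definition stratification A (Z : set (set 'rV[R]_n)) : Prop :=
  [/\ finite_set Z,
      partition Z id A,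
      forall S, Z S -> exists k, submanifold k S &
      forall S T, Z S -> Z T -> S `&` closure T !=set0 -> S `<=` closure T].

End Euclidean.

Section Orthogonal.
Variables (R : realType) (n : nat).

Record orth := Orth {
  orth_mx :> 'M[R]_n;
  orth_mxP : orth_mx^T *m orth_mx == 1%:M }.

HB.instance Definition _ := [isSub for orth_mx].
HB.instance Definition _ := [Choice of orth by <:].

Fact orth1_subproof : (1%:M : 'M[R]_n)^T *m 1%:M == 1%:M.
Proof. by rewrite trmx1 mul1mx. Qed.
Fact orthM_subproof (A B : orth) :
  ((A *m B : 'M[R]_n))^T *m (A *m B) == 1%:M.
Proof.
by rewrite trmx_mul -mulmxA (mulmxA A^T) (eqP (orth_mxP A)) mul1mx
  (eqP (orth_mxP B)).
Qed.
Fact orthV_subproof (A : orth) : ((A^T)^T : 'M[R]_n) *m A^T == 1%:M.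
Proof. by rewrite trmxK; apply/eqP/mulmx1C/eqP/orth_mxP. Qed.

Definition orth_one := Orth orth1_subproof.
Definition orth_mul A B := Orth (orthM_subproof A B).
Definition orth_inv A := Orth (orthV_subproof A).

Fact orth_mulA : associative orth_mul.
Proof. by move=> A B C; apply/val_inj; rewrite /= mulmxA. Qed.
Fact orth_mul1 : left_id orth_one orth_mul.
Proof. by move=> A; apply/val_inj; rewrite /= mul1mx. Qed.
Fact orth_mulr1 : right_id orth_one orth_mul.
Proof. by move=> A; apply/val_inj; rewrite /= mulmx1. Qed.
Fact orth_mulV : left_inverse orth_one orth_inv orth_mul.
Proof. by move=> A; apply/val_inj/eqP/orth_mxP. Qed.
Fact orth_mulrV : right_inverse orth_one orth_inv orth_mul.
Proof. by move=> A; apply/val_inj; exact/mulmx1C/eqP/orth_mxP. Qed.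

HB.instance Definition _ :=
  isGroup.Build orth orth_mulA orth_mul1 orth_mulr1 orth_mulV orth_mulrV.

End Orthogonal.

(* The norm that matrices carry in the analysis library is the sup norm, hence
   the separate Euclidean one. *)
Definition dot (R : realType) (n : nat) (u v : 'cV[R]_n) : R := (u^T *m v) 0 0.
Definition enorm (R : realType) (n : nat) (u : 'cV[R]_n) : R :=
  Num.sqrt (dot u u).

Fact dotC (R : realType) (n : nat) (u v : 'cV[R]_n) : dot u v = dot v u.
Proof. by rewrite /dot -[u^T *m v]trmxK mxE trmx_mul trmxK. Qed.

(* The ambient dimension is n = 1 + m; the splitting R^n = R x R^(n-1) is given
   by usubmx and dsubmx. *)
Section CotangentSphere.
Variables (R : realType) (m : nat).

Definition cotangent_sphere : set ('cV[R]_(1 + m) * 'cV[R]_(1 + m)) :=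
  [set x | enorm x.1 = 1 /\ dot x.1 x.2 = 0].

Definition rot (h : 'M[R]_m) (u : 'cV[R]_(1 + m)) : 'cV[R]_(1 + m) :=
  col_mx (usubmx u) (h *m dsubmx u).

Fact dot_rot (h : orth R m) u v : dot (rot h u) (rot h v) = dot u v.
Proof.
rewrite /dot /rot -[in RHS](vsubmxK u) -[in RHS](vsubmxK v).
rewrite !tr_col_mx !mul_row_col trmx_mul -mulmxA (mulmxA h^T).
by rewrite (eqP (orth_mxP h)) mul1mx.
Qed.

Fact rot_subproof (h : orth R m) (x : cotangent_sphere) :
  (rot h (val x).1, rot h (val x).2) \in cotangent_sphere.
Proof.
by case: x => x /=; rewrite !inE /cotangent_sphere /enorm /= !dot_rot.
Qed.

Definition cotangent_act (h : orth R m) (x : cotangent_sphere) :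
  cotangent_sphere := SigSub (rot_subproof h x).

Fact cotangent_act1 x : cotangent_act 1%g x = x.
Proof.
apply/val_inj; case: x => -[q p] /= _.
by rewrite /rot !mul1mx !vsubmxK.
Qed.

Fact cotangent_actM (g h : orth R m) x :
  cotangent_act (g * h)%g x = cotangent_act g (cotangent_act h x).
Proof.
by apply/val_inj; rewrite /= /rot !col_mxKu !col_mxKd !mulmxA.
Qed.

Definition cotangent_action : action (orth R m) cotangent_sphere :=
  Action cotangent_act1 cotangent_actM.

Definition invariants (x : cotangent_sphere) : 'rV[R]_3 :=
  let: (q, p) := val x in
  \row_(i < 3) [:: usubmx q 0 0; usubmx p 0 0; enorm p ^+ 2]`_i.

End CotangentSphere.

Arguments cotangent_sphere : clear implicits.
Arguments cotangent_action : clear implicits.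

Section VeselovaTop.
Variables (R : realType) (m : nat).
Local Notation n := (1 + m)%N.

Definition e1 : 'cV[R]_n := delta_mx 0 0.

Definition wedgemx (a b : 'cV[R]_n) : 'M[R]_n := a *m b^T - b *m a^T.

Definition veselova_space : set ('M[R]_n * 'M[R]_n) :=
  [set x | [/\ x.1^T *m x.1 = 1%:M, x.2^T = - x.2 &
               exists v, x.2 = wedgemx (invmx x.1 *m e1) v]].

Definition fix_e1 : {pred orth R n} := fun A => (A : 'M[R]_n) *m e1 == e1.

Record stab_e1 := StabE1 { stab_orth :> orth R n; stab_orthP : fix_e1 stab_orth }.

HB.instance Definition _ := [isSub for stab_orth].
HB.instance Definition _ := [Choice of stab_e1 by <:].

Fact orth_inv_mulK (A : orth R n) (u v : 'cV[R]_n) :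
  (A : 'M[R]_n) *m u = v -> (A^-1%g : orth R n) *m v = u.
Proof. by move=> <-; rewrite mulmxA (eqP (orth_mxP A)) mul1mx. Qed.

Fact stab_e1_closed : group_closed fix_e1.
Proof.
split; first by rewrite unfold_in mul1mx.
move=> A B /eqP hA /eqP hB; rewrite unfold_in; apply/eqP.
by rewrite /= -mulmxA (orth_inv_mulK hB).
Qed.

HB.instance Definition _ :=
  SubChoice_isSubGroup.Build (orth R n) fix_e1 stab_e1 stab_e1_closed.

Fact stab_e1V (A : stab_e1) : (A : 'M[R]_n)^T *m e1 = e1.
Proof. exact: orth_inv_mulK (eqP (stab_orthP A)). Qed.

Fact orth_invmx (A : 'M[R]_n) : A^T *m A = 1%:M -> invmx A = A^T.
Proof.
move=> h; have [_ uA] := mulmx1_unit h.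
by rewrite -[LHS]mul1mx -h -mulmxA mulmxV // mulmx1.
Qed.

Definition veselova_act0 (c : stab_e1 * stab_e1) (x : 'M[R]_n * 'M[R]_n) :=
  let: (A, B) := c in
  let: (g, Omega) := x in
  ((A : 'M[R]_n) *m g *m (B^-1%g : stab_e1), (B : 'M[R]_n) *m Omega *m (B^-1%g : stab_e1)).

Fact veselova_act_subproof c (x : veselova_space) :
  veselova_act0 c (val x) \in veselova_space.
Proof.
case: c => A B; case: x => -[g W]; rewrite /= !inE /= => -[/= hg hW [v hv]].
have hA := eqP (orth_mxP A); have hB := eqP (orth_mxP B).
have hB' := mulmx1C hB.
have hg' : (A *m g *m B^T)^T *m (A *m g *m B^T) = 1%:M.
  rewrite !trmx_mul trmxK -!mulmxA (mulmxA A^T) hA mul1mx (mulmxA g^T) hg mul1mx.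
  exact: hB'.
split=> //=.
  by rewrite !trmx_mul trmxK hW mulNmx mulmxN mulmxA.
exists ((B : 'M[R]_n) *m v).
have e : invmx (A *m g *m B^T) *m e1 = (B : 'M[R]_n) *m (invmx g *m e1).
  by rewrite (orth_invmx hg') (orth_invmx hg) !trmx_mul trmxK -!mulmxA stab_e1V.
rewrite -[invmx _ *m e1]/(invmx (A *m g *m B^T) *m e1) e hv /wedgemx.
by rewrite mulmxBr mulmxBl !(trmx_mul B) !mulmxA.
Qed.

Definition veselova_act (c : stab_e1 * stab_e1) (x : veselova_space) :
  veselova_space := SigSub (veselova_act_subproof c x).

Fact veselova_act1 x : veselova_act 1%g x = x.
Proof.
apply/val_inj; case: x => -[g W] /= _.
by rewrite !trmx1 !mul1mx !mulmx1.
Qed.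

Fact veselova_actM (c d : stab_e1 * stab_e1) x :
  veselova_act (c * d)%g x = veselova_act c (veselova_act d x).
Proof.
case: c d => [A B] [A' B']; apply/val_inj; case: x => -[g W] /= _.
by rewrite !trmx_mul !mulmxA.
Qed.

Definition veselova_action : action (stab_e1 * stab_e1)%type veselova_space :=
  Action veselova_act1 veselova_actM.

Variables (J1 J2 : R).

Definition mass_tensor : 'M[R]_n := block_mx J1%:M 0 0 J2%:M.

Definition inertia (Omega : 'M[R]_n) : 'M[R]_n :=
  mass_tensor *m Omega + Omega *m mass_tensor.

Definition legendre0 (x : 'M[R]_n * 'M[R]_n) : 'cV[R]_n * 'cV[R]_n :=
  let: (g, Omega) := x in
  (invmx g *m e1, - (inertia Omega *m (invmx g *m e1))).

Fact legendre_subproof (x : veselova_space) :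
  legendre0 (val x) \in cotangent_sphere R m.
Proof.
case: x => -[g W]; rewrite /= !inE /= => -[/= hg hW _].
have hg' := mulmx1C hg; rewrite /cotangent_sphere /= (orth_invmx hg).
set q := g^T *m e1.
have qq : dot q q = 1.
  rewrite /dot /q trmx_mul trmxK -mulmxA (mulmxA g) hg' mul1mx.
  by rewrite /e1 trmx_delta mul_delta_mx mxE !eqxx.
split; first by rewrite /enorm qq sqrtr1.
have hJ : mass_tensor^T = mass_tensor.
  by rewrite /mass_tensor tr_block_mx !tr_scalar_mx !trmx0.
have hI : (inertia W)^T = - inertia W.
  by rewrite /inertia linearD /= !trmx_mul hW hJ mulNmx mulmxN opprD addrC.
have : dot q (inertia W *m q) = - dot q (inertia W *m q).
  rewrite [LHS](dotC _ _) /dot trmx_mul hI.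
  by rewrite -mulmxA mulNmx mulmxN mxE.
move/eqP; rewrite -addr_eq0 -mulr2n mulrn_eq0 /= => /eqP h.
by rewrite /dot mulmxN mxE -/(dot _ _) h oppr0.
Qed.

Definition legendre (x : veselova_space) : cotangent_sphere R m :=
  SigSub (legendre_subproof x).

End VeselovaTop.

Arguments veselova_space : clear implicits.
Arguments veselova_action : clear implicits.

Definition reduced_space (R : realType) : set 'rV[R]_3 :=
  [set x | let q1 := x 0 (inord 0) in
           let p1 := x 0 (inord 1) in
           let P := x 0 (inord 2) in
           [/\ p1 ^+ 2 <= (1 - q1 ^+ 2) * P, -1 <= q1 <= 1 & 0 <= P]].

Arguments reduced_space : clear implicits.

(* Main.v *)
Require Import Defs.
From HB Require Import structures.
From mathcomp Require Import all_boot all_order all_algebra.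
From mathcomp Require Import all_classical all_reals all_analysis.
From mathcomp Require Import ring lra.
From mathcomp Require Import (canonicals) mpoly.

Set Implicit Arguments.
Unset Strict Implicit.
Unset Printing Implicit Defensive.

Import Order.TTheory GRing.Theory Num.Theory.
Import numFieldNormedType.Exports.

Local Open Scope classical_set_scope.
Local Open Scope ring_scope.

(** The orbit of [(q, p)] under [O(m)] depends only on the components [q1], [p1]
    and on the components [q2], [p2] in [R^m], and two pairs of vectors of [R^m]
    are related by an orthogonal map exactly when they have the same Gram matrix
    ([orth_transport]). The relations [|q| = 1] and [q . p = 0] express the Gram
    matrix of [(q2, p2)] through the invariants: its entries are [1 - q1^2],
    [- q1 p1] and [P - p1^2], and its determinant is [(1 - q1^2) P - p1^2]. So
    the invariants separate the orbits, and their values are the triples for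
    which this matrix is positive semidefinite, each of which is attained as
    soon as [R^m] has room for two orthonormal vectors. The positive
    semidefinite square root of a Gram matrix is a pair of vectors with that
    Gram matrix and depends continuously on it, including at [0]; this gives a
    continuous section of the invariants ([sphere_section]), hence a continuous
    inverse on the orbit space ([homeomorphism_of_section]).

    The isotropy group of a pair of vectors is determined up to conjugation by
    the rank of the pair, and determines it ([pair_fixer_conjP]). The orbit types
    are therefore given by the rank of the Gram matrix: rank [0] is the two
    points [(1, 0, 0)] and [(-1, 0, 0)], rank [1] the other points of the
    reduced space with [(1 - q1^2) P = p1^2], and rank [2] the interior. The
    defining function of this surface is a submersion away from the two points,
    and explicit paths show that each stratum lies in the closure of those of
    larger rank ([reduced_space_stratification]).

    For the unreduced system, the vector [v] in [Omega = q /\ v] may be taken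
    orthogonal to [q] and is then a function of [(q, p)], because the inertia
    tensor is invertible on such bivectors ([legendre_velocity]). It follows that
    the map to the cotangent bundle is equivariant ([legendre_equivariant]) with
    the orbits of the left group as fibres ([legendre_fiber]), so that the
    description of the orbits is inherited. Two points need an argument. The
    section must be lifted to the orthogonal group; the sphere has no global lift
    in general, but there is one over the image of the
    section, which avoids a point of the sphere ([attitude_section]). And points
    with conjugate isotropy groups in the cotangent bundle must have conjugate
    isotropy groups upstairs, where the left factor remembers [q]
    ([veselova_same_orbit_type]). *)

(** * Euclidean geometry and reflections *)

Section Dot.
Variables (R : realType) (k : nat).
Implicit Types (u v w : 'cV[R]_k) (a : R).

Lemma dotDl u v w : dot (u + v) w = dot u w + dot v w.
Proof. by rewrite /dot linearD /= mulmxDl mxE. Qed.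
Lemma dotZl a u v : dot (a *: u) v = a * dot u v.
Proof. by rewrite /dot linearZ /= -scalemxAl mxE. Qed.
Lemma dotDr u v w : dot u (v + w) = dot u v + dot u w.
Proof. by rewrite dotC dotDl !(dotC u). Qed.
Lemma dotZr a u v : dot u (a *: v) = a * dot u v.
Proof. by rewrite dotC dotZl dotC. Qed.
Lemma dotNl u v : dot (- u) v = - dot u v.
Proof. by rewrite -scaleN1r dotZl mulN1r. Qed.
Lemma dotNr u v : dot u (- v) = - dot u v.
Proof. by rewrite dotC dotNl dotC. Qed.
Lemma dot0l u : dot 0 u = 0.
Proof. by rewrite /dot trmx0 mul0mx mxE. Qed.
Lemma dot0r u : dot u 0 = 0.
Proof. by rewrite dotC dot0l. Qed.

Definition dotE := (dotDl, dotDr, dotNl, dotNr, dotZl, dotZr, dot0l, dot0r).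

Lemma dot_sum u v : dot u v = \sum_i u i 0 * v i 0.
Proof. by rewrite /dot mxE; apply: eq_bigr => i _; rewrite mxE. Qed.

Lemma dot_ge0 u : 0 <= dot u u.
Proof. by rewrite dot_sum sumr_ge0 // => i _; rewrite -expr2 sqr_ge0. Qed.

Lemma dot_eq0 u : (dot u u == 0) = (u == 0).
Proof.
apply/eqP/eqP => [h|->]; last by rewrite dot0l.
apply/matrixP => i j; rewrite ord1 mxE.
move: h; rewrite dot_sum => /psumr_eq0P h.
have /eqP := h (fun i _ => sqr_ge0 (u i 0)) i isT.
by rewrite mulf_eq0 orbb => /eqP.
Qed.

Lemma dot_gt0 u : (0 < dot u u) = (u != 0).
Proof. by rewrite lt_def dot_eq0 dot_ge0 andbT. Qed.

Lemma enorm_sqr u : enorm u ^+ 2 = dot u u.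
Proof. by rewrite sqr_sqrtr // dot_ge0. Qed.

Lemma mul_outer u v w : (u *m v^T) *m w = dot v w *: u.
Proof.
by rewrite -mulmxA [v^T *m w]mx11_scalar -[(v^T *m w) 0 0]/(dot v w)
  mul_mx_scalar.
Qed.

Lemma orth_mulK (h : orth R k) p (u : 'M[R]_(k,
  p)) : (h : 'M[R]_k)^T *m (h *m u) = u.
Proof. by rewrite mulmxA (eqP (orth_mxP h)) mul1mx. Qed.

Lemma orth_mulVK (h : orth R k) p (u : 'M[R]_(k,
  p)) : (h : 'M[R]_k) *m (h^T *m u) = u.
Proof. by rewrite mulmxA (mulmx1C (eqP (orth_mxP h))) mul1mx. Qed.

Lemma dot_orth (h : orth R k) u v : dot (h *m u) (h *m v) = dot u v.
Proof. by rewrite {1}/dot trmx_mul -mulmxA orth_mulK. Qed.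

(** When [w = 0] the scalar factor is [2 / 0 = 0], so that this is the identity
    and remains orthogonal. *)
Definition reflection_mx w : 'M[R]_k := 1%:M - (2 / dot w w) *: (w *m w^T).

Lemma reflection_mxE w u :
  reflection_mx w *m u = u - (2 * dot w u / dot w w) *: w.
Proof.
by rewrite mulmxBl mul1mx -scalemxAl mul_outer scalerA mulrAC.
Qed.

Lemma reflection_mx_tr w : (reflection_mx w)^T = reflection_mx w.
Proof. by rewrite /reflection_mx linearB linearZ /= trmx1 trmx_mul trmxK. Qed.

Fact reflection_subproof w :
  (reflection_mx w)^T *m reflection_mx w == 1%:M.
Proof.
rewrite reflection_mx_tr {2}/reflection_mx mulmxBr mulmx1 -scalemxAr mulmxA.
rewrite reflection_mxE mulmxBl -scalemxAl scalerBr scalerA {1}/reflection_mx.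
have [->|w0] := eqVneq w 0.
  by rewrite mul0mx !scaler0 !subr0.
rewrite -dot_eq0 in w0.
have -> : 2 / dot w w * (2 * dot w w / dot w w) = 2 / dot w w + 2 / dot w w.
  by rewrite mulfK //; ring.
by rewrite scalerDl; apply/eqP/matrixP => i j; rewrite !mxE; ring.
Qed.

Definition reflection w : orth R k := Orth (reflection_subproof w).

Lemma reflection_fix w u : dot w u = 0 -> reflection_mx w *m u = u.
Proof. by rewrite reflection_mxE => ->; rewrite mulr0 mul0r scale0r subr0. Qed.

Lemma reflection_neg w : reflection_mx w *m w = - w.
Proof.
rewrite reflection_mxE; have [->|] := eqVneq w 0;
  first by rewrite scaler0 subr0 oppr0.
by rewrite -dot_eq0 => w0; rewrite mulfK // scaler_nat mulr2n opprD addNKr.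
Qed.

(** The hyperplane orthogonal to [u - v] is the one across which two vectors of
    the same length are mirror images. *)
Lemma reflection_swap u v :
  dot u u = dot v v -> reflection_mx (u - v) *m u = v.
Proof.
move=> e; have [uv|uv] := eqVneq u v.
  by rewrite uv subrr reflection_fix // dot0l.
rewrite reflection_mxE; have : u - v != 0 by rewrite subr_eq0.
rewrite -dot_eq0 !dotE opprK (dotC v u) e => h.
have -> : 2 * (dot v v - dot u v) / (dot v v - dot u v + (- dot u v + dot v v))
  = 1.
  rewrite (_ : 2 * _ = dot v v - dot u v + (- dot u v + dot v v)); last by ring.
  rewrite divff //; apply: contra h => /eqP h; apply/eqP; rewrite -{}h; ring.
by rewrite scale1r opprB addrC subrK.
Qed.

Lemma reflection_comm (h : orth R k) w : (h : 'M[R]_k) *m w = w ->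
  (h : 'M[R]_k) *m reflection_mx w = reflection_mx w *m h.
Proof.
move=> hw; rewrite mulmxBr mulmxBl mulmx1 mul1mx -scalemxAr -scalemxAl.
rewrite mulmxA hw -mulmxA; congr (_ - _ *: (_ *m _)).
by rewrite -{1}(orth_mulK h w) hw trmx_mul trmxK.
Qed.

(** Two reflections suffice: one to match the first vectors, and a second one
    that matches the second vectors and whose mirror contains the first. *)
Lemma orth_transport u v u' v' :
  dot u u = dot u' u' -> dot u v = dot u' v' -> dot v v = dot v' v' ->
  exists h : orth R k, (h : 'M[R]_k) *m u = u' /\ (h : 'M[R]_k) *m v = v'.
Proof.
move=> uu uv vv; pose r := reflection (u - u').
have ru : (r : 'M[R]_k) *m u = u' by exact: reflection_swap.
pose w := (r : 'M[R]_k) *m v.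
exists (reflection (w - v') * r)%g; rewrite -!mulmxA ru.
split; last by apply: reflection_swap; rewrite dot_orth.
by apply: reflection_fix; rewrite !dotE -ru dot_orth ru (dotC v) uv dotC subrr.
Qed.

End Dot.

(** * Isotropy groups and orbit projections *)

Section Isotropy.
Variables (G : groupType) (X : topologicalType) (a : action G X).

Lemma actK g : cancel (a g) (a g^-1%g).
Proof. by move=> x; rewrite -actMg mulVg act1g. Qed.

Lemma isotropy_act g x :
  isotropy a (a g x) = [set (h ^ g^-1)%g | h in isotropy a x].
Proof.
apply/seteqP; split=> [h /= hx|_ [h /= hx <-]].
  exists (h ^ g)%g; last by rewrite -conjgM mulgV conjg1.
  by rewrite /isotropy /= conjgE !actMg hx actK.
by rewrite /isotropy /= conjgE invgK !actMg actK hx.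
Qed.

Lemma same_orbit_typeP x y :
  same_orbit_type a x y <-> exists g, isotropy a y = isotropy a (a g x).
Proof.
split=> -[g e]; exists g^-1%g; first by rewrite isotropy_act invgK.
by rewrite e isotropy_act.
Qed.

Lemma orbit_proj_eq x y :
  orbit_proj a x = orbit_proj a y <-> exists g, a g x = y.
Proof.
by split=> [/eqmodP /asboolP|/asboolP h] //; exact/eqmodP.
Qed.

Lemma orbit_proj_surj (u : orbit_space a) : exists x, orbit_proj a x = u.
Proof. by exists (repr u); rewrite /orbit_proj reprK. Qed.

End Isotropy.

(** * Pairs of vectors up to orthogonal maps *)

Section PairTypes.
Variables (R : realType) (k : nat).
Implicit Types (u v w : 'cV[R]_k).

Definition pair_fixer u v : set (orth R k) :=
  [set h | (h : 'M[R]_k) *m u = u /\ (h : 'M[R]_k) *m v = v].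

Definition gram_det u v : R := dot u u * dot v v - dot u v ^+ 2.

(** The rank of the family [u], [v]: for a nonzero pair, independence is detected
    by the Gram determinant. *)
Definition pair_rank u v : nat :=
  ((u != 0) || (v != 0)) + (0 < gram_det u v)%R.

Lemma gram_det_proj u v : dot u u != 0 ->
  let w := v - (dot u v / dot u u) *: u in
  dot u w = 0 /\ gram_det u v = dot u u * dot w w.
Proof.
move=> u0 w; rewrite /w /gram_det !dotE (dotC v u).
by split; field.
Qed.

Lemma gram_det_ge0 u v : 0 <= gram_det u v.
Proof.
have [->|] := eqVneq u 0; first by rewrite /gram_det !dotE expr0n mul0r subr0.
rewrite -dot_eq0 => u0; have [_ ->] := gram_det_proj v u0.
by rewrite mulr_ge0 ?dot_ge0.
Qed.

Lemma gram_detC u v : gram_det u v = gram_det v u.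
Proof. by rewrite /gram_det (dotC v u) mulrC. Qed.

Lemma pair_fixerC u v : pair_fixer u v = pair_fixer v u.
Proof. by apply/seteqP; split=> h []. Qed.

Lemma pair_rankC u v : pair_rank u v = pair_rank v u.
Proof. by rewrite /pair_rank gram_detC orbC. Qed.

Lemma pair_rank_orth (h : orth R k) u v :
  pair_rank (h *m u) (h *m v) = pair_rank u v.
Proof. by rewrite /pair_rank /gram_det -!dot_eq0 !dot_orth. Qed.

Lemma pair_rank_le2 u v : (pair_rank u v <= 2)%N.
Proof. exact: leq_add (leq_b1 _) (leq_b1 _). Qed.

Lemma normalize u : u != 0 ->
  let w := (Num.sqrt (dot u u))^-1 *: u in
  dot w w = 1 /\ (forall h : 'M[R]_k, h *m w = w <-> h *m u = u).
Proof.
move=> u0; set c := Num.sqrt _ => w.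
have c0 : c != 0 by rewrite sqrtr_eq0 -ltNge dot_gt0.
split; first by rewrite !dotE -[dot u u]sqr_sqrtr ?dot_ge0 // -/c; field.
move=> h; rewrite -scalemxAr; split=> [|-> //].
by move/scalerI; apply; rewrite invr_eq0.
Qed.

(** Gram-Schmidt: orthonormalising the pair does not change which orthogonal
    maps fix it, so that up to the action of the orthogonal group the fixer
    depends on the rank only. *)
Lemma pair_orthonormal u v : exists u' v',
  [/\ pair_fixer u v = pair_fixer u' v',
      dot u' u' = (0 < pair_rank u v)%N%:R, dot u' v' = 0 &
      dot v' v' = (1 < pair_rank u v)%N%:R].
Proof.
wlog u0 : u v / (u == 0) ==> (v == 0).
  move=> H; have [u0|u0] := eqVneq u 0; last by apply: H; rewrite (negPf u0).
  have [v0|v0] := eqVneq v 0; first by apply: H; rewrite u0 v0 eqxx.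
  by rewrite pair_fixerC pair_rankC; apply: H; rewrite (negPf v0).
have [ue|un] := eqVneq u 0.
  move: u0; rewrite ue eqxx /= => /eqP ->; exists 0, 0.
  by rewrite /pair_rank /gram_det !dotE expr0n mul0r subr0 eqxx ltxx.
have un' := un; rewrite -dot_eq0 in un'.
have [uw gE] := gram_det_proj v un'; set w := v - _ in uw gE.
have [c1 fixc] := normalize un; set c := _ *: u in c1 fixc.
have fixw (h : 'M[R]_k) : h *m u = u -> h *m v = v <-> h *m w = w.
  move=> hu; rewrite mulmxBr -scalemxAr hu; split=> [-> //|].
  by rewrite /w => /addIr.
have E : pair_rank u v = (1 + (w != 0)%R)%N.
  by rewrite /pair_rank un gE pmulr_rgt0 ?dot_gt0.
have [w0|wn] := eqVneq w 0.
  exists c, 0; rewrite E w0 eqxx /= !dot0r; split; rewrite ?c1 //.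
  apply/seteqP; split => h [h1 h2]; split.
  - exact/fixc.
  - by rewrite mulmx0.
  - exact/fixc.
  - by apply/fixw; [exact/fixc | rewrite w0 mulmx0].
have [d1 fixd] := normalize wn; set d := _ *: w in d1 fixd.
exists c, d; rewrite E wn; split; rewrite ?c1 ?d1 //;
  last by rewrite /c /d dotZl dotZr uw !mulr0.
apply/seteqP; split => h [h1 h2]; split.
- exact/fixc.
- exact/fixd/fixw.
- exact/fixc.
- by apply/fixw; [exact/fixc | exact/fixd].
Qed.

(** If the second pair had the larger rank, its span would contain a nonzero
    vector orthogonal to the first pair; the reflection in that vector fixes the
    first pair but not the second. *)
Lemma pair_fixer_sub_rank u v u' v' :
  pair_fixer u v `<=` pair_fixer u' v' -> (pair_rank u' v' <= pair_rank u v)%N.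
Proof.
have [c [d [-> cc cd dd]]] := pair_orthonormal u v.
have [c' [d' [-> cc' cd' dd']]] := pair_orthonormal u' v'.
have := pair_rank_le2 u' v'; move: cc dd cc' dd'.
move: (pair_rank u v) (pair_rank u' v') => r r' cc dd cc' dd' r2 sub.
rewrite leqNgt; apply/negP => rr.
have key w : dot w c = 0 -> dot w d = 0 ->
    (exists x y, w = x *: c' + y *: d') -> w = 0.
  move=> wc wd [x [y wE]].
  have [|h1 h2] := sub (reflection w); first by split; exact: reflection_fix.
  have h3 : reflection_mx w *m w = w.
    by rewrite {2 3}wE mulmxDr -!scalemxAr h1 h2.
  have /eqP := reflection_neg w; rewrite h3 -subr_eq0 opprK -mulr2n.
  by rewrite -scaler_nat scaler_eq0 pnatr_eq0 /= => /eqP.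
have [r0|r0] := posnP r.
  move: cc dd; rewrite r0 => /eqP; rewrite dot_eq0 => /eqP c0 /eqP.
  rewrite dot_eq0 => /eqP d0.
  have c'0 : c' = 0.
    apply: key; rewrite ?c0 ?d0 ?dot0r //.
    by exists 1, 0; rewrite scale1r scale0r addr0.
  move: cc'; rewrite c'0 dot0l (leq_ltn_trans (leq0n r) rr).
  by move=> /esym/eqP; rewrite oner_eq0.
have r1 : r = 1%N by apply/eqP;
  rewrite eqn_leq r0 andbT -ltnS (leq_trans rr r2).
have r'2 : r' = 2%N by apply/eqP; rewrite eqn_leq r2 -r1.
move: cc dd cc' dd'; rewrite r1 r'2 /= => cc /eqP;
  rewrite dot_eq0 => /eqP d0 cc' dd'.
(* Rank 1 against rank 2: this combination of [c'] and [d'] is orthogonal to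
   [c]. *)
have w0 : dot c d' *: c' - dot c c' *: d' = 0.
  apply: key.
  - by rewrite !dotE (dotC c' c) (dotC d' c); ring.
  - by rewrite d0 dot0r.
  - by exists (dot c d'), (- dot c c'); rewrite scaleNr.
have e1 : dot c c' = 0.
  have := congr1 (dot d') w0;
    rewrite !dotE (dotC d' c') cd' dd' mulr1 mulr0 add0r.
  by move/eqP; rewrite oppr_eq0 => /eqP.
have c'0 : c' = 0.
  apply: key; rewrite ?d0 ?dot0r // 1?dotC //.
  by exists 1, 0; rewrite scale1r scale0r addr0.
by move: cc'; rewrite c'0 dot0l => /esym/eqP; rewrite oner_eq0.
Qed.

(** A map between orthonormal families of the same size conjugates their
    fixers. *)
Lemma pair_fixer_conjP u v u' v' :
  (exists h : orth R k, pair_fixer u' v' = pair_fixer (h *m u) (h *m v)) <->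
  pair_rank u' v' = pair_rank u v.
Proof.
split=> [[h e]|e].
  apply/eqP; rewrite -(pair_rank_orth h u v) eqn_leq.
  by rewrite !pair_fixer_sub_rank // e.
have [c [d [e1 cc cd dd]]] := pair_orthonormal u v.
have [c' [d' [e2 cc' cd' dd']]] := pair_orthonormal u' v'.
have [||| h [hc hd]] := @orth_transport R k c d c' d'.
- by rewrite cc cc' e.
- by rewrite cd cd'.
- by rewrite dd dd' e.
have conj (g : orth R k) a b : pair_fixer (h *m a) (h *m b) g <->
    pair_fixer a b (g ^ h)%g.
  rewrite /pair_fixer conjgE /= -!mulmxA; split=> -[h1 h2].
    by rewrite h1 h2 !orth_mulK.
  by rewrite -{2}h1 -{2}h2 !orth_mulVK.
exists h; rewrite e2 -hc -hd; apply/seteqP; split=> g /conj.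
  by rewrite -e1 => /conj.
by rewrite e1 => /conj.
Qed.

End PairTypes.

(** * Continuity and orbit spaces *)

Section Continuity.
Variables (R : realType) (T : topologicalType).

Lemma continuous_mx m n (f : T -> 'M[R]_(m, n)) :
  (forall i j, continuous (fun x => f x i j)) -> continuous f.
Proof.
move=> fc x A [P fxP PA]; rewrite nbhs_filterE /=.
have : \forall y \near x, forall ij : 'I_m * 'I_n, P ij.1 ij.2 (f y ij.1 ij.2).
  by apply: filter_forall => -[i j] /=; exact: fc.
by apply: filterS => y H; apply: PA => i j; exact: H (i, j).
Qed.

Lemma continuous_entry m n (f : T -> 'M[R]_(m, n)) i j :
  continuous f -> continuous (fun x => f x i j).
Proof.
move=> fc x; apply: (@continuous_comp _ _ _ f (fun M : 'M[R]_(m, n) => M i j)).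
  exact: fc.
exact: coord_continuous.
Qed.

Lemma continuous_add (V : normedModType R) (f g : T -> V) :
  continuous f -> continuous g -> continuous (fun x => f x + g x).
Proof. by move=> fc gc x; apply: continuousD; [exact: fc|exact: gc]. Qed.

Lemma continuous_opp (V : normedModType R) (f : T -> V) :
  continuous f -> continuous (fun x => - f x).
Proof. by move=> fc x; apply: continuousN; exact: fc. Qed.

Lemma continuous_mul (f g : T -> R) :
  continuous f -> continuous g -> continuous (fun x => f x * g x).
Proof. by move=> fc gc x; apply: continuousM; [exact: fc|exact: gc]. Qed.

Lemma continuous_sqr (f : T -> R) :
  continuous f -> continuous (fun x => f x ^+ 2).
Proof. by move=> fc; exact: (continuous_mul fc fc). Qed.

Lemma continuous_scale (V : normedModType R) (f : T -> R) (g : T -> V) :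
  continuous f -> continuous g -> continuous (fun x => f x *: g x).
Proof. by move=> fc gc x; apply: continuousZ; [exact: fc|exact: gc]. Qed.

Lemma continuous_inv (f : T -> R) :
  (forall x, f x != 0) -> continuous f -> continuous (fun x => (f x)^-1).
Proof. by move=> f0 fc x; apply: continuousV; [exact: f0|exact: fc]. Qed.

Lemma continuous_sqrt (f : T -> R) :
  continuous f -> continuous (fun x => Num.sqrt (f x)).
Proof.
move=> fc x; apply: (@continuous_comp _ _ _ f (@Num.sqrt R)); first exact: fc.
exact: sqrt_continuous.
Qed.

Lemma continuous_maxr (f g : T -> R) :
  continuous f -> continuous g -> continuous (fun x => Num.max (f x) (g x)).
Proof. by move=> fc gc x; apply: continuous_max; [exact: fc|exact: gc]. Qed.

Lemma continuous_minr (f g : T -> R) :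
  continuous f -> continuous g -> continuous (fun x => Num.min (f x) (g x)).
Proof. by move=> fc gc x; apply: continuous_min; [exact: fc|exact: gc]. Qed.

Lemma continuous_mulmx m n p (f : T -> 'M[R]_(m, n)) (g : T -> 'M[R]_(n, p)) :
  continuous f -> continuous g -> continuous (fun x => f x *m g x).
Proof.
move=> fc gc; apply: continuous_mx => i j.
under eq_fun do rewrite mxE.
apply: continuous_big => [|k _]; first exact: add_continuous.
by apply: continuous_mul; exact: continuous_entry.
Qed.

Lemma continuous_trmx m n (f : T -> 'M[R]_(m, n)) :
  continuous f -> continuous (fun x => (f x)^T).
Proof.
move=> fc; apply: continuous_mx => i j.
by under eq_fun do rewrite mxE; exact: continuous_entry.
Qed.

Lemma continuous_pair (U V : topologicalType) (f : T -> U) (g : T -> V) :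
  continuous f -> continuous g -> continuous (fun x => (f x, g x)).
Proof. by move=> fc gc x; apply: cvg_pair; [exact: fc|exact: gc]. Qed.

(** The quotient is understood to be [0] where [t] vanishes; the quadratic
    bound forces the limit of [f / t] to be [0] there. *)
Lemma continuous_div_sqr (f t : T -> R) :
  continuous f -> continuous t -> (forall x, `|f x| <= t x ^+ 2) ->
  continuous (fun x => f x / t x).
Proof.
move=> fc tc ft x; have [tx0|tx0] := eqVneq (t x) 0; last first.
  apply: (@continuousM _ _ f (fun y => (t y)^-1)); first exact: fc.
  by apply: continuousV => //; exact: tc.
have bound y : `|f y / t y| <= `|t y|.
  have [->|ty] := eqVneq (t y) 0; first by rewrite invr0 mulr0 normr0.
  by rewrite normrM normfV ler_pdivrMr ?normr_gt0 // -expr2 real_normK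
    ?num_real.
rewrite /continuous_at tx0 invr0 mulr0; apply/norm_cvg0P.
apply: (@squeeze_cvgr _ _ _ _ (cst 0) (fun y => `|t y|)).
- by near=> y; rewrite /cst normr_ge0 bound.
- exact: cvg_cst.
- by rewrite -(normr0 R) -tx0; apply: cvg_norm; exact: tc.
Unshelve. all: by end_near. Qed.

End Continuity.

Lemma continuous_fst_comp (T U V : topologicalType) (f : T -> U * V) :
  continuous f -> continuous (fun x => (f x).1).
Proof. by move=> fc x; apply: (@continuous_comp _ _ _ f fst);
  [exact: fc|exact: cvg_fst]. Qed.
Lemma continuous_snd_comp (T U V : topologicalType) (f : T -> U * V) :
  continuous f -> continuous (fun x => (f x).2).
Proof. by move=> fc x; apply: (@continuous_comp _ _ _ f snd);
  [exact: fc|exact: cvg_snd]. Qed.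
Lemma continuous_set_val (T : topologicalType) (D : set T) :
  continuous (fun x : D => set_val x).
Proof. exact: initial_continuous. Qed.

(** The preimage under [s] of an open set of the ambient space [T] is open, which
    makes the induced bijection open onto [A]; no compactness of the group is
    involved. Asking for a section that is continuous on all of [Y], with values
    in [T], avoids the subspace topologies of [A] and [D]. *)
Lemma homeomorphism_of_section (T Y : topologicalType) (D : set T)
    (G : groupType) (a : action G D) (f : D -> Y) (A : set Y) (s : Y -> T) :
  continuous f ->
  (forall x y, f x = f y <-> exists g, a g x = y) ->
  (forall x, A (f x)) ->
  continuous s -> (forall y, A y -> exists2 x : D, set_val x = s y & f x = y) ->
  exists phi : orbit_space a -> Y,
    (forall x, phi (orbit_proj a x) = f x) /\ homeomorphism_onto phi A.
Proof.
move=> fc forb fA sc sP; pose phi (u : orbit_space a) := f (repr u).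
have phiE x : phi (orbit_proj a x) = f x.
  by apply/forb/orbit_proj_eq; rewrite /orbit_proj reprK.
exists phi; split=> //; split.
- apply/quotient_continuous; rewrite (_ : _ \o _ = f) //.
  by apply/funext => x; exact: phiE.
- move=> u v; have [x <-] := orbit_proj_surj u;
  have [y <-] := orbit_proj_surj v.
  by rewrite !phiE => /forb e; exact/orbit_proj_eq.
- apply/seteqP; split=> [_ [u _ <-]|y Ay]; first exact: fA.
  by have [x _ <-] := sP y Ay; exists (orbit_proj a x).
- move=> U [W oW WU]; exists (s @^-1` W); first by apply: open_comp => // y _;
  exact: sc.
  have WUP x : W (set_val x) <-> U (orbit_proj a x).
    by rewrite -[X in X <-> _]/((set_val @^-1` W) x) WU.
  apply/seteqP; split=> [_ [u Uu <-]|y [Ay /= Wy]].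
    split; first exact: fA.
    have [x e fx] := sP _ (fA (repr u)).
    rewrite /preimage /= -e; apply/WUP.
    by have /forb/orbit_proj_eq := fx; rewrite /orbit_proj reprK => ->.
  have [x e fx] := sP _ Ay; exists (orbit_proj a x); last by rewrite phiE.
  by apply/WUP; rewrite e.
Qed.

(** * Polynomial maps *)

Section PolynomialMaps.
Variables (R : realType) (n : nat).
Implicit Types (f g : 'rV[R]_n -> R).

Inductive polynomial_fun : ('rV[R]_n -> R) -> Prop :=
| polynomial_cst c : polynomial_fun (cst c)
| polynomial_coord i : polynomial_fun (fun x => x 0 i)
| polynomialD f g :
    polynomial_fun f -> polynomial_fun g -> polynomial_fun (f + g)
| polynomialM f g :
    polynomial_fun f -> polynomial_fun g -> polynomial_fun (f * g).

Lemma polynomial_differentiable f x : polynomial_fun f -> differentiable f x.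
Proof.
elim=> [c|i|{}f g _ hf _ hg|{}f g _ hf _ hg].
- exact: differentiable_cst.
- exact: differentiable_coord.
- exact: differentiableD.
- exact: differentiableM.
Qed.

Lemma is_derive_coord (x v : 'rV[R]_n) i :
  is_derive x v (fun y : 'rV[R]_n => y 0 i) (v 0 i).
Proof.
apply: DeriveDef; first exact/diff_derivable/differentiable_coord.
have := @derive_mx R 'rV[R]_n 1 n id x v (@derivable_id _ _ x v).
by move/matrixP => /(_ 0 i); rewrite derive_id mxE => ->.
Qed.

Lemma polynomial_derive f j :
  polynomial_fun f -> polynomial_fun ('D_(delta_mx 0 j) f).
Proof.
move=> pf; elim: pf => [c|i|{}f g pf hf pg hg|{}f g pf hf pg hg].
- rewrite (_ : 'D_ _ _ = cst 0); first exact: polynomial_cst.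
  by apply/funext => x; rewrite derive_cst.
- rewrite (_ : 'D_ _ _ = cst ((delta_mx 0 j : 'rV[R]_n) 0 i));
  first exact: polynomial_cst.
  by apply/funext => x;
    have := is_derive_coord x (delta_mx 0 j) i => /@derive_val.
- rewrite (_ : 'D_ _ _ = 'D_(delta_mx 0 j) f + 'D_(delta_mx 0 j) g);
  first exact: polynomialD.
  apply/funext => x; rewrite deriveD //;
  exact/diff_derivable/polynomial_differentiable.
- rewrite (_ : 'D_ _ _ = f * 'D_(delta_mx 0 j) g + g * 'D_(delta_mx 0 j) f).
    by apply: polynomialD; apply: polynomialM.
  apply/funext => x; rewrite deriveM //;
  exact/diff_derivable/polynomial_differentiable.
Qed.

Definition polynomial_map k (F : 'rV[R]_n -> 'rV[R]_k) : Prop :=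
  forall i, polynomial_fun (fun x => F x 0 i).

Lemma polynomial_map_differentiable k (F : 'rV[R]_n -> 'rV[R]_k) x :
  polynomial_map F -> differentiable F x.
Proof.
move=> pF; rewrite (_ : F = \sum_i (fun y => F y 0 i *: delta_mx 0 i)).
  apply: differentiable_sum => i; apply: differentiableZl.
  exact: polynomial_differentiable.
by apply/funext => y; rewrite fct_sumE -row_sum_delta.
Qed.

Lemma polynomial_map_iter_partial k (F : 'rV[R]_n -> 'rV[R]_k) s :
  polynomial_map F -> polynomial_map (iter_partial s F).
Proof.
move=> pF; elim: s => [//|j s IH] i /=.
rewrite (_ : (fun _ => _) = 'D_(delta_mx 0 j) (fun x =>
  iter_partial s F x 0 i)).
  exact: polynomial_derive.
apply/funext => x; rewrite derive_mx ?mxE //.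
exact/diff_derivable/polynomial_map_differentiable.
Qed.

(** Iterated partial derivatives of a polynomial map are again polynomial, hence
    differentiable. *)
Lemma polynomial_map_smooth k (F : 'rV[R]_n -> 'rV[R]_k) U :
  polynomial_map F -> smooth_on U F.
Proof.
move=> /polynomial_map_iter_partial pF s x _.
have dF := polynomial_map_differentiable x (pF s).
by split=> [|j]; [exact: differentiable_continuous | exact: diff_derivable].
Qed.

End PolynomialMaps.

(** * Semialgebraicity of the reduced space *)

Section Reduced.
Variable (R : realType).
Local Notation vec3 := 'rV[R]_3.
Implicit Types (y : vec3).

Definition pt3 (a b c : R) : vec3 := \row_(i < 3) [:: a; b; c]`_i.

Lemma pt3E a b c : (pt3 a b c 0 (inord 0) = a) * (pt3 a b c 0 (inord 1) = b) *
  (pt3 a b c 0 (inord 2) = c).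
Proof. by rewrite !mxE !inordK. Qed.

Lemma ord3P (P : 'I_3 -> Prop) : P (inord 0) -> P (inord 1) -> P (inord 2) ->
  forall i, P i.
Proof.
move=> P0 P1 P2 [[|[|[|//]]] h].
- by rewrite (_ : Ordinal h = inord 0) //; apply/val_inj; rewrite /= inordK.
- by rewrite (_ : Ordinal h = inord 1) //; apply/val_inj; rewrite /= inordK.
- by rewrite (_ : Ordinal h = inord 2) //; apply/val_inj; rewrite /= inordK.
Qed.

Lemma pt3_eta y : y = pt3 (y 0 (inord 0)) (y 0 (inord 1)) (y 0 (inord 2)).
Proof. by apply/rowP; apply: ord3P; rewrite !pt3E. Qed.

Lemma semialgebraic_ge0 n (f : mpoly.mpoly n R) :
  semialgebraic [set x : 'rV[R]_n | 0 <= mpoly.meval (fun i => x 0 i) f].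
Proof.
have := semialgebraicC (semialgebraic_pos (- f)).
congr semialgebraic; apply/seteqP; split=> x /=;
  by rewrite mpoly.mevalN oppr_gt0 leNgt => /negP.
Qed.

Lemma reduced_space_semialgebraic : semialgebraic (reduced_space R).
Proof.
pose X (i : 'I_3) : mpoly.mpoly 3 R := mpoly.mpolyX R (mpoly.mnm1 i).
pose q := X (inord 0); pose p := X (inord 1); pose P := X (inord 2).
have := semialgebraicI (semialgebraic_ge0 ((1 - q ^+ 2) * P - p ^+ 2))
  (semialgebraicI (semialgebraic_ge0 (q + 1))
     (semialgebraicI (semialgebraic_ge0 (1 - q)) (semialgebraic_ge0 P))).
congr semialgebraic; apply/seteqP; rewrite /q /p /P /X.
split=> x; rewrite /reduced_space /= !(mpoly.mevalB, mpoly.mevalD,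
  mpoly.mevalM, rmorphXn,
   mpoly.meval1, mpoly.mevalXU).
  move=> [h1 [h2 [h3 h4]]]; split; [by rewrite -subr_ge0| |by []].
  by apply/andP; split; lra.
by move=> [h1 /andP[h2 h3] h4]; do !split; rewrite ?subr_ge0 //; lra.
Qed.

End Reduced.

(** * Stratification of the reduced space *)

Section Strata.
Variable (R : realType).
Local Notation vec3 := 'rV[R]_3.
Implicit Types (y : vec3).

Local Notation q1 y := (y 0 (inord 0)).
Local Notation p1 y := (y 0 (inord 1)).
Local Notation P y := (y 0 (inord 2)).

(** The determinant of the Gram matrix of [(q2, p2)], see
    [gram_det_invariants]. *)
Definition gap y : R := (1 - q1 y ^+ 2) * P y - p1 y ^+ 2.
Definition is_tip y := [&& q1 y ^+ 2 == 1, p1 y == 0 & P y == 0].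
(** The rank of the Gram matrix, see [pair_rank_invariants]. *)
Definition reduced_rank y : nat := ~~ is_tip y + (0 < gap y)%R.
Definition stratum (k : nat) : set vec3 :=
  [set y | reduced_space R y /\ reduced_rank y = k].

Lemma tip_gap y : is_tip y -> gap y = 0.
Proof. by case/and3P => /eqP h1 /eqP h2 /eqP h3; rewrite /gap h1 h2 h3;
  ring. Qed.

Lemma stratum0E : stratum 0 = [set y | is_tip y].
Proof.
apply/seteqP; split => [y [_]|y /= ty]; rewrite /stratum /= /reduced_rank.
  by move=> /eqP; rewrite addn_eq0 eqb0 negbK => /andP[].
split; last by rewrite ty (tip_gap ty) ltxx.
case/and3P: ty => /eqP h1 /eqP h2 /eqP h3; rewrite /reduced_space /= h2 h3.
split; [by rewrite mulr0 expr0n | by apply/andP; split; nra | by []].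
Qed.

(** This form exhibits the stratum as the zero set of [gap] in an open set: there
    [gap y = 0] forces the inequalities of the reduced space, since
    [(1 - q1^2) P = p1^2] is nonnegative. *)
Lemma stratum1E : stratum 1 =
  [set y : vec3 | (q1 y ^+ 2 < 1 \/ 0 < P y) /\ gap y = 0].
Proof.
apply/seteqP; split => [y [[h1 /andP[h2 h3] h4]]|y /= [h g]];
  rewrite /stratum /= /reduced_rank.
  have g0 : 0 <= gap y by rewrite subr_ge0.
  have [ty|nty] := boolP (is_tip y); first by rewrite (tip_gap ty) ltxx.
  have [//|g1] := ltrP 0 (gap y); move=> _; split; last by apply: le_anti;
    rewrite g0 g1.
  have [|P0] := ltrP 0 (P y); [by right|left].
  have PE : P y = 0 by apply: le_anti; rewrite h4 P0.
  have p0 : p1 y = 0.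
    by apply/eqP; rewrite -sqrf_eq0 eq_le sqr_ge0 andbT; rewrite PE mulr0 in h1.
  rewrite lt_def eq_sym; move: nty; rewrite /is_tip PE p0 !eqxx !andbT => ->;
    nra.
split; last first.
  rewrite g ltxx addn0; case: (boolP (is_tip y)) => // /and3P[/eqP e _ /eqP P0].
  by case: h; rewrite ?e ?P0 ltxx.
rewrite /gap in g; have e : p1 y ^+ 2 = (1 - q1 y ^+ 2) * P y by lra.
have p2 := sqr_ge0 (p1 y).
have [q2 P2] : q1 y ^+ 2 <= 1 /\ 0 <= P y by case: h => h; split; nra.
by split; [rewrite e | apply/andP; split; nra | ].
Qed.

Lemma stratum2E :
  stratum 2 = [set y : vec3 | [/\ -1 < q1 y, q1 y < 1 & 0 < gap y]].
Proof.
apply/seteqP; split => [y [[h1 /andP[h2 h3] h4]]|y /= [h2 h3 g]];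
  rewrite /stratum /= /reduced_rank.
  case: (is_tip y) => //=; case: ltrP => //= g _.
  rewrite /gap in g; have p2 := sqr_ge0 (p1 y).
  have q2 : 0 < 1 - q1 y ^+ 2 by rewrite ltNge; apply/negP; nra.
  by move: (q1 y) q2 h2 h3 => q *; split=> //; nra.
rewrite g; have -> /= : is_tip y = false by apply/negP => /tip_gap g0;
  rewrite g0 ltxx in g.
split=> //; rewrite /gap in g; have := sqr_ge0 (p1 y).
have q2 : 0 < 1 - q1 y ^+ 2 by nra.
by split; [lra | apply/andP; split; lra | nra].
Qed.

Lemma reduced_rank_lt3 y : (reduced_rank y < 3)%N.
Proof. by rewrite ltnS; exact: leq_add (leq_b1 _) (leq_b1 _). Qed.

Lemma reduced_space_strata : reduced_space R = \bigcup_(k in [set k | (k <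
  3)%N]) stratum k.
Proof.
apply/seteqP; split => [y hy|y [k _ [//]]]; exists (reduced_rank y) => //=.
exact: reduced_rank_lt3.
Qed.

Lemma continuous_gap : continuous gap.
Proof.
have cst_c : continuous (fun _ : vec3 => 1 : R) by exact: cst_continuous.
have cc (i : 'I_3) : continuous (fun y : vec3 => y 0 i)
  by exact: coord_continuous.
apply: continuous_add; last by apply: continuous_opp; exact: continuous_sqr.
apply: continuous_mul => //; apply: continuous_add => //.
by apply: continuous_opp; exact: continuous_sqr.
Qed.

Lemma submanifold0 : submanifold 0 (stratum 0).
Proof.
rewrite stratum0E => x /= tx; pose F (y : vec3) := y - x.
(* The sign condition on [q1] separates the two points of the stratum. *)
exists 3%N, [set y : vec3 | 0 < q1 x * q1 y], F.
have pF : polynomial_map F.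
  move=> i; rewrite (_ : (fun _ => _) = (fun y => y 0 i) + cst (- x 0 i)).
    by apply: polynomialD; [exact: polynomial_coord|exact: polynomial_cst].
  by apply/funext => y; rewrite /F !mxE.
have xx : 0 < q1 x * q1 x by case/and3P: tx => /eqP h _ _; rewrite -expr2 h.
split=> //.
- split=> //.
  apply: (@open_comp _ _ (fun y : vec3 => q1 x * q1 y) [set r | 0 < r]);
    last exact: open_gt.
  by move=> y _; apply: continuous_mul;
    [exact: cst_continuous|exact: coord_continuous].
- exact: polynomial_map_smooth.
- move=> y _; rewrite (_ : 'J F y = 1%:M) ?mxrank1 //.
  apply/row_matrixP => i; rewrite rowE -deriveEjacobian;
    last exact: polynomial_map_differentiable.
  by rewrite row1 (_ : F = id - cst x) // derive_val subr0.
- apply/seteqP; split => y /= [h1 h2]; last first.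
    by move/eqP: h2; rewrite subr_eq0 => /eqP e; rewrite e in h1 *.
  split=> //; apply/eqP; rewrite subr_eq0; apply/eqP.
  case/and3P: h1 => /eqP a1 /eqP a2 /eqP a3;
    case/and3P: tx => /eqP b1 /eqP b2 /eqP b3.
  rewrite [LHS]pt3_eta [RHS]pt3_eta a2 a3 b2 b3; congr pt3.
  have /eqP : (q1 y - q1 x) * (q1 y + q1 x) = 0
    by rewrite -subr_sqr a1 b1 subrr.
  rewrite mulf_eq0 subr_eq0 addr_eq0 => /orP[/eqP//|/eqP e]; rewrite e in h2.
  by exfalso; nra.
Qed.

(** The gradient [(- 2 q1 P, - 2 p1, 1 - q1^2)] of [gap] vanishes only if
    [q1^2 = 1] and [P = 0]. *)
Lemma submanifold1 : submanifold 2 (stratum 1).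
Proof.
move=> x Sx; pose F (y : vec3) : 'rV[R]_1 := const_mx (gap y).
pose X i : vec3 -> R := fun y => y 0 i.
have gE : gap = (cst 1 + cst (-1) * (X (inord 0) * X (inord 0))) * X (inord 2) +
   cst (-1) * (X (inord 1) * X (inord 1)).
  apply/funext => y; rewrite /gap.
  change ((1 - q1 y ^+ 2) * P y - p1 y ^+ 2 =
    (1 + -1 * (q1 y * q1 y)) * P y + -1 * (p1 y * p1 y)); ring.
have pX i : polynomial_fun (X i) by exact: polynomial_coord.
have pC (c : R) : polynomial_fun (cst c : vec3 -> R) by exact: polynomial_cst.
have pg : polynomial_fun gap.
  rewrite gE.
  apply: polynomialD; apply: polynomialM => //; last exact: polynomialM.
  by apply: polynomialD => //; do 2 apply: polynomialM => //.
have pF : polynomial_map F.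
  by move=> i; rewrite (_ : (fun _ => _) = gap) //; apply/funext => y;
    rewrite mxE.
exists 1%N, [set y : vec3 | q1 y ^+ 2 < 1 \/ 0 < P y], F; split=> //.
- split; last by move: Sx; rewrite stratum1E => -[].
  apply: openU.
    apply: (@open_comp _ _ (fun y : vec3 => q1 y ^+ 2) [set r | r < 1]);
      last exact: open_lt.
    by move=> y _; apply: continuous_sqr; exact: coord_continuous.
  apply: (@open_comp _ _ (fun y : vec3 => P y) [set r | 0 < r]);
    last exact: open_gt.
  by move=> y _; exact: coord_continuous.
- exact: polynomial_map_smooth.
- move=> y Uy; apply/eqP; rewrite eqn_leq rank_leq_col lt0n mxrank_eq0.
  apply/eqP => J0.
  have D0 i : 'D_(delta_mx 0 i) gap y = 0.
    have dF := polynomial_map_differentiable y pF.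
    have := deriveEjacobian (delta_mx 0 i) dF; rewrite J0 mulmx0 derive_mx;
      last exact: diff_derivable.
    move/matrixP => /(_ 0 0); rewrite mxE [RHS]mxE.
    by rewrite (_ : (fun _ => _) = gap) //; apply/funext => z; rewrite /F mxE.
  have dE v : 'D_v gap y = (1 - q1 y ^+ 2) * v 0 (inord 2)
      - 2 * q1 y * P y * v 0 (inord 0) - 2 * p1 y * v 0 (inord 1).
    have dp f : polynomial_fun f -> derivable f y v.
      by move=> pf; exact/diff_derivable/polynomial_differentiable.
    have dX i : 'D_v (X i) y = v 0 i
      by exact: (@derive_val _ _ _ _ _ _ _ (is_derive_coord y v i)).
    have pXX i : polynomial_fun (X i * X i) by exact: polynomialM.
    rewrite gE deriveD; [|by apply: dp; do ?apply: polynomialM => //;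
      apply: polynomialD => //; exact: polynomialM|by apply: dp;
        exact: polynomialM].
    rewrite deriveM; [|by apply: dp; apply: polynomialD => //;
      exact: polynomialM|exact: dp].
    rewrite deriveD; [|exact: dp|by apply: dp; exact: polynomialM].
    do 2 (rewrite deriveM; [|exact: dp|exact: dp]); rewrite !derive_cst.
    rewrite !deriveM; do ?exact: dp.
    rewrite !derive_cst !dX.
    rewrite !fctE /X /GRing.scale /=; ring.
  have := D0 (inord 2); have := D0 (inord 0).
  rewrite !dE !mxE !eqxx /= -!val_eqE /= !inordK //= !(mulr0, mulr1, subr0,
    sub0r).
  case: Uy; clear; move: (q1 y) (P y) => a b h; nra.
- rewrite stratum1E; apply/seteqP; split => y /=.
    by move=> [[h g] _]; split=> //; rewrite /F g; apply/matrixP => i j;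
      rewrite !mxE.
  by move=> [h /matrixP/(_ 0 0)]; rewrite !mxE.
Qed.

Lemma open_stratum2 : open (stratum 2).
Proof.
rewrite stratum2E (_ : [set _ | _] = (fun y : vec3 =>
  q1 y) @^-1` [set r | -1 < r] `&`
  ((fun y : vec3 => q1 y) @^-1` [set r | r < 1] `&` gap @^-1` [set r | 0 <
    r])); last first.
  by apply/seteqP; split => y /=; [move=> []|move=> [? []]].
apply: openI; last apply: openI.
- by apply: open_comp; [move=> y _; exact: coord_continuous | exact: open_gt].
- by apply: open_comp; [move=> y _; exact: coord_continuous | exact: open_lt].
- by apply: open_comp; [move=> y _; exact: continuous_gap | exact: open_gt].
Qed.

Lemma submanifold2 : submanifold 3 (stratum 2).
Proof.
move=> x Sx; exists 0%N, (stratum 2), (fun=> 0); split=> //.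
- by split=> //; exact: open_stratum2.
- by apply: polynomial_map_smooth => -[].
- by move=> y _; apply/eqP; rewrite -leqn0 rank_leq_col.
- by apply/seteqP; split => y /= [].
Qed.

Lemma closure_path (T : set vec3) (c : R -> vec3) :
  continuous c -> (forall e, 0 < e -> e < 1 -> T (c e)) -> closure T (c 0).
Proof.
move=> cc cT B /(cc 0)/nbhs_ballP[d /= d0 dB].
pose e := Num.min d 1 / 2.
have m0 : 0 < Num.min d 1 by rewrite lt_min d0 ltr01.
have e0 : 0 < e by rewrite divr_gt0.
have em : e < Num.min d 1 by rewrite /e; lra.
have [ed e1] : e < d /\ e < 1 by apply/andP; rewrite -lt_min.
exists (c e); split; first exact: cT.
by apply: dB; rewrite /ball /= sub0r normrN gtr0_norm.
Qed.

Lemma continuous_pt3 (T : topologicalType) (a b c : T -> R) :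
  continuous a -> continuous b -> continuous c ->
  continuous (fun t => pt3 (a t) (b t) (c t)).
Proof.
move=> ca cb cc; apply: continuous_mx => i j; rewrite ord1.
by move: j; apply: ord3P; under eq_fun do rewrite pt3E.
Qed.

(** Shrinking [q1] and [p1] while increasing [P] moves any point of the reduced
    space into its interior. *)
Lemma reduced_space_closure : reduced_space R `<=` closure (stratum 2).
Proof.
move=> y [h1 /andP[h2 h3] h4].
have := @closure_path (stratum 2) (fun e =>
  pt3 (q1 y * (1 - e)) (p1 y * (1 - e)) (P y + e)).
rewrite subr0 !mulr1 addr0 -pt3_eta; apply.
  have c1 : continuous (fun e : R => 1 - e).
    by move=> e; apply: cvgB; [exact: cst_continuous|exact: cvg_id].
  have cst_c (k : R) : continuous (fun _ : R => k) by exact: cst_continuous.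
  apply: continuous_pt3; [exact: continuous_mul..|].
  by apply: continuous_add => // e; exact: cvg_id.
move=> e e0 e1; rewrite stratum2E /= /gap !pt3E.
have q2 : q1 y ^+ 2 <= 1 by nra.
have u0 : 0 < 1 - e by lra.
have u1 : (1 - e) ^+ 2 < 1 by nra.
have u2 : 0 < (1 - e) ^+ 2 by nra.
split; [nra | nra |].
move: (1 - e) u0 u1 u2 => u u0 u1 u2; rewrite !exprMn.
have k1 : 0 < 1 - q1 y ^+ 2 * u ^+ 2 by nra.
have k2 : p1 y ^+ 2 * u ^+ 2 <= (1 - q1 y ^+ 2) * P y * u ^+ 2 by nra.
have k3 : (1 - q1 y ^+ 2) * P y * u ^+ 2 <= (1 - q1 y ^+ 2 * u ^+ 2) * P y
  by nra.
nra.
Qed.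

Lemma stratum0_closure : stratum 0 `<=` closure (stratum 1).
Proof.
rewrite stratum0E => y /and3P[/eqP h1 /eqP h2 /eqP h3].
have -> : y = (fun e => pt3 (q1 y) (p1 y) e) 0 by rewrite -h3 -pt3_eta.
apply: closure_path.
  have cst_c (k : R) : continuous (fun _ : R => k) by exact: cst_continuous.
  by apply: continuous_pt3 => // e; exact: cvg_id.
move=> e e0 e1; rewrite stratum1E /= /gap !pt3E h1 h2.
by split; [right|rewrite subrr expr0n mul0r subr0].
Qed.

Lemma stratum_sub_closure j k :
  (j <= k)%N -> (k < 3)%N -> stratum j `<=` closure (stratum k).
Proof.
case: k => [|[|[|//]]]; case: j => [|[|[|//]]] // _ _;
  try exact: subset_closure.
- exact: stratum0_closure.
- by apply: subset_trans reduced_space_closure => y [].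
- by apply: subset_trans reduced_space_closure => y [].
Qed.

Lemma closed_tip : closed [set y | is_tip y].
Proof.
have cc (i : 'I_3) : continuous (fun y : vec3 => y 0 i)
  by exact: coord_continuous.
rewrite (_ : [set _ | _] = (fun y : vec3 => q1 y ^+ 2) @^-1` [set 1] `&`
  ((fun y : vec3 => p1 y) @^-1` [set 0] `&` (fun y : vec3 =>
    P y) @^-1` [set 0])).
  by do ?apply: closedI; (apply: preimage_closed;
    [move=> y _ | exact: closed_eq]);
    [exact: continuous_sqr|exact: cc|exact: cc].
apply/seteqP; split => y /=; first by case/and3P => /eqP ? /eqP ? /eqP ?.
by move=> [h1 [h2 h3]]; apply/and3P; split; apply/eqP.
Qed.

(** The two closed conditions [is_tip] and [gap = 0] cut out the strata of rank
    at most [0] and at most [1]. *)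
Lemma closure_stratum_rank j k : stratum j `&` closure (stratum k) !=set0 ->
  (j <= k)%N.
Proof.
case: k => [|[|k]] [y [[yR <-] cy]].
- suff ty : is_tip y by rewrite /reduced_rank ty (tip_gap ty) ltxx.
  by apply: closed_tip; rewrite -stratum0E.
- suff gy : gap y = 0 by rewrite /reduced_rank gy ltxx addn0 leq_b1.
  have : closed (gap @^-1` [set 0]).
    by apply: preimage_closed; [move=> z _;
      exact: continuous_gap | exact: closed_eq].
  apply; apply: closureS cy.
  by rewrite stratum1E => z [].
- by apply: (@leq_trans 2) => //; rewrite -ltnS reduced_rank_lt3.
Qed.

Lemma stratum_nonempty k : (k < 3)%N -> stratum k !=set0.
Proof.
case: k => [|[|[|//]]] _.
- by exists (pt3 1 0 0); rewrite stratum0E /= /is_tip !pt3E expr1n !eqxx.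
- exists (pt3 0 0 0); rewrite stratum1E /= /gap !pt3E; split; last by ring.
  by left; rewrite expr0n.
- exists (pt3 0 0 1); rewrite stratum2E /= /gap !pt3E; by split;
  rewrite ?expr0n /=; lra.
Qed.

Lemma reduced_space_stratification :
  stratification (reduced_space R) [set stratum k | k in [set k | (k < 3)%N]].
Proof.
split.
- by apply: finite_image; exact: finite_II.
- split.
  + apply/seteqP; split => [y [_ [k _ <-] []]//|y].
    by rewrite reduced_space_strata => -[k k3 ky]; exists (stratum k) => //;
      exists k.
  + by move=> _ _ [j _ <-] [k _ <-] /= [y [[_ <-] [_ <-]]].
  + by move=> _ [k k3 <-]; exact: stratum_nonempty.
- move=> _ [[|[|[|//]]] _ <-].
  + by exists 0%N; exact: submanifold0.
  + by exists 2%N; exact: submanifold1.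
  + by exists 3%N; exact: submanifold2.
- move=> _ _ [j j3 <-] [k k3 <-] /closure_stratum_rank jk.
  exact: stratum_sub_closure.
Qed.

End Strata.

(** * Invariants on the cotangent bundle of the sphere *)

Section CotangentSphere.
Variables (R : realType) (m : nat).
Local Notation T := (cotangent_sphere R m).
Local Notation space := ('cV[R]_(1 + m) * 'cV[R]_(1 + m))%type.
Implicit Types (u v : 'cV[R]_(1 + m)) (x y : T).

Lemma dot_split u v :
  dot u v = usubmx u 0 0 * usubmx v 0 0 + dot (dsubmx u) (dsubmx v).
Proof.
rewrite -{1}(vsubmxK u) -{1}(vsubmxK v) /dot tr_col_mx mul_row_col mxE.
by rewrite [X in X + _]mxE big_ord1 mxE.
Qed.

Lemma vec_eq u v :
  usubmx u 0 0 = usubmx v 0 0 -> dsubmx u = dsubmx v -> u = v.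
Proof.
move=> e1 e2; rewrite -(vsubmxK u) -(vsubmxK v) e2; congr col_mx.
by apply/matrixP => i j; rewrite !ord1.
Qed.

Lemma cotangent_sphereP (z : space) :
  cotangent_sphere R m z <-> dot z.1 z.1 = 1 /\ dot z.1 z.2 = 0.
Proof.
split=> -[h1 h2]; split=> //; first by rewrite -enorm_sqr h1 expr1n.
by rewrite /enorm h1 sqrtr1.
Qed.

Lemma invariantsE x :
  invariants x = pt3 (usubmx (val x).1 0 0) (usubmx (val x).2 0 0)
                     (dot (val x).2 (val x).2).
Proof. by rewrite /invariants; case: (val x) => q p; rewrite enorm_sqr. Qed.

Lemma gram_of_invariants x (y := invariants x)
    (q2 := dsubmx (val x).1) (p2 := dsubmx (val x).2) :
  [/\ dot q2 q2 = 1 - y 0 (inord 0) ^+ 2,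
      dot q2 p2 = - (y 0 (inord 0) * y 0 (inord 1)) &
      dot p2 p2 = y 0 (inord 2) - y 0 (inord 1) ^+ 2].
Proof.
rewrite /y invariantsE !pt3E; have := set_valP x => /cotangent_sphereP.
rewrite /q2 /p2 !dot_split => -[h1 h2]; split; last by ring.
- by rewrite -h1; ring.
- by apply/eqP; rewrite -addr_eq0 addrC h2.
Qed.

Lemma gram_det_invariants x :
  gram_det (dsubmx (val x).1) (dsubmx (val x).2) = gap (invariants x).
Proof.
by have [e1 e2 e3] := gram_of_invariants x; rewrite /gram_det /gap e1 e2 e3;
  ring.
Qed.

Lemma invariants_reduced x : reduced_space R (invariants x).
Proof.
have [e1 e2 e3] := gram_of_invariants x.
have := dot_ge0 (dsubmx (val x).1); have := dot_ge0 (dsubmx (val x).2).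
have := gram_det_ge0 (dsubmx (val x).1) (dsubmx (val x).2).
rewrite gram_det_invariants e1 e3 /reduced_space /= /gap => h1 h2 h3.
split; [by rewrite -subr_ge0 | by apply/andP; split; nra | nra].
Qed.

(** At [q1^2 = 1] the defining inequality already gives [p1 = 0], so that the
    vanishing of the diagonal Gram entries is the condition [is_tip]. *)
Lemma pair_rank_invariants x :
  pair_rank (dsubmx (val x).1) (dsubmx (val x).2) = reduced_rank (invariants x).
Proof.
rewrite /pair_rank /reduced_rank gram_det_invariants;
  congr (nat_of_bool _ + _)%N.
have [e1 _ e3] := gram_of_invariants x.
rewrite -!dot_eq0 e1 e3 -negb_and; congr negb.
have [] := invariants_reduced x; rewrite /is_tip.
move: (_ 0 (inord 0)) (_ 0 (inord 1)) (_ 0 (inord 2)) => q1 p1 P h _ _.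
rewrite subr_eq0 (eq_sym 1); case: eqP => //= q1E.
have -> : p1 = 0.
  by apply/eqP; rewrite -sqrf_eq0 eq_le sqr_ge0 andbT (le_trans h) // q1E subrr
    mul0r.
by rewrite eqxx expr0n subr0.
Qed.

Lemma cotangent_orbitP x y :
  invariants x = invariants y <-> exists h, cotangent_action R m h x = y.
Proof.
split=> [e|[h <-]].
  have [a1 a2 a3] := gram_of_invariants x.
  have [b1 b2 b3] := gram_of_invariants y.
  have [||| h [hq hp]] := @orth_transport R m
    (dsubmx (val x).1) (dsubmx (val x).2)
    (dsubmx (val y).1) (dsubmx (val y).2);
      rewrite ?a1 ?a2 ?a3 ?b1 ?b2 ?b3 ?e //.
  exists h; apply/val_inj; move: e; rewrite !invariantsE /= => e.
  have := congr1 (fun z : 'rV_3 => z 0 (inord 0)) e.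
  have := congr1 (fun z : 'rV_3 => z 0 (inord 1)) e.
  rewrite /= !pt3E => e1 e0; rewrite [RHS]surjective_pairing.
  by congr pair; apply: vec_eq; rewrite ?col_mxKu ?col_mxKd.
by rewrite !invariantsE /= !col_mxKu dot_rot.
Qed.

Lemma cotangent_isotropy x : isotropy (cotangent_action R m) x =
  pair_fixer (dsubmx (val x).1) (dsubmx (val x).2).
Proof.
apply/seteqP; split=> h /=.
  move=> /(congr1 val) /= e.
  by split; [rewrite -[RHS](congr1 (fun z =>
    dsubmx z.1) e) | rewrite -[RHS](congr1 (fun z => dsubmx z.2) e)];
    rewrite /= col_mxKd.
move=> [h1 h2]; apply/val_inj; rewrite /= [RHS]surjective_pairing.
by congr pair; apply: vec_eq; rewrite ?col_mxKu ?col_mxKd.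
Qed.

Lemma cotangent_same_orbit_type x y :
  same_orbit_type (cotangent_action R m) x y <->
  reduced_rank (invariants y) = reduced_rank (invariants x).
Proof.
rewrite same_orbit_typeP -!pair_rank_invariants -pair_fixer_conjP.
by split=> -[h e]; exists h; move: e; rewrite !cotangent_isotropy /= !col_mxKd.
Qed.

Lemma continuous_invariants : continuous (@invariants R m : T -> 'rV[R]_3).
Proof.
rewrite (_ : @invariants _ _ = fun x => pt3 ((set_val x).1 (lshift m 0) 0)
   ((set_val x).2 (lshift m 0) 0) (dot (set_val x).2 (set_val x).2));
     last first.
  by apply/funext => x; rewrite invariantsE !mxE.
have c1 := continuous_fst_comp (@continuous_set_val _ T).
have c2 := continuous_snd_comp (@continuous_set_val _ T).
apply: continuous_pt3; [exact: continuous_entry..|].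
by apply: continuous_entry; apply: continuous_mulmx => //;
  exact: continuous_trmx.
Qed.

End CotangentSphere.

(** * A continuous section of the invariants *)

(** By Cayley-Hamilton, the positive semidefinite square root of a symmetric
    positive semidefinite matrix [G] of size 2 is
    [(G + sqrt (det G)) / sqrt (tr G + 2 sqrt (det G))]. With division by zero
    equal to zero the formula stays true for [G = 0]. *)
Lemma sqrt_psd2 (R : rcfType) (A B C : R) (s := Num.sqrt (A * C - B ^+ 2))
    (t := Num.sqrt (A + C + 2 * s)) : 0 <= A -> 0 <= C -> B ^+ 2 <= A * C ->
  [/\ ((A + s) / t) ^+ 2 + (B / t) ^+ 2 = A,
      (A + s) / t * (B / t) + B / t * ((C + s) / t) = B &
      (B / t) ^+ 2 + ((C + s) / t) ^+ 2 = C].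
Proof.
move=> A0 C0 BAC; have s0 : 0 <= s := sqrtr_ge0 _.
have s2 : s ^+ 2 = A * C - B ^+ 2 by rewrite sqr_sqrtr // subr_ge0.
have t2 : t ^+ 2 = A + C + 2 * s by rewrite sqr_sqrtr //; lra.
have [tz|tn] := eqVneq t 0.
  rewrite tz expr0n /= in t2; rewrite tz invr0 !mulr0 expr0n /= addr0.
  have [A00 C00] : A = 0 /\ C = 0 by split; lra.
  have B0 : B ^+ 2 = 0 by apply: le_anti;
    rewrite sqr_ge0 andbT (le_trans BAC) // A00 mul0r.
  by split=> //; apply/esym/eqP; rewrite -sqrf_eq0 B0.
rewrite !exprMn exprVn -!mulrDl.
have key (k : R) X : X = k * t ^+ 2 -> X / t ^+ 2 = k.
  by move=> ->; rewrite mulfK // sqrf_eq0.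
split.
- by apply: key; rewrite t2; ring: s2.
- by rewrite !mulf_div -mulrDl -expr2; apply: key; rewrite t2; ring.
- by apply: key; rewrite t2; ring: s2.
Qed.

Section SphereSection.
Variables (R : realType) (m : nat) (f0 f1 : 'cV[R]_m).
Hypotheses (f00 : dot f0 f0 = 1) (f01 : dot f0 f1 = 0) (f11 : dot f1 f1 = 1).
Local Notation vec3 := 'rV[R]_3.
Implicit Types (y : vec3).
Local Notation q1 y := (y 0 (inord 0)).
Local Notation p1 y := (y 0 (inord 1)).
Local Notation P y := (y 0 (inord 2)).

(** The Gram entries are truncated so that [gramA], [gramC >= 0] and
    [|gramB| <= gramA + gramC] hold on all of [R^3]: the section is then
    continuous everywhere, and no truncation occurs on the reduced space
    ([gram_reduced]). *)
Definition gramA y : R := Num.max 0 (1 - q1 y ^+ 2).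
Definition gramC y : R := Num.max 0 (P y - p1 y ^+ 2).
Definition gramB y : R :=
  Num.max (- (gramA y + gramC y)) (Num.min (gramA y + gramC y) (- (q1 y * p1
    y))).
Definition root_det y : R := Num.sqrt (gap y).
Definition root_trace y : R := Num.sqrt (gramA y + gramC y + 2 * root_det y).

Definition root11 y : R := (gramA y + root_det y) / root_trace y.
Definition root12 y : R := gramB y / root_trace y.
Definition root22 y : R := (gramC y + root_det y) / root_trace y.

Definition sphere_section y : 'cV[R]_(1 + m) * 'cV[R]_(1 + m) :=
  (col_mx (q1 y)%:M (root11 y *: f0 + root12 y *: f1),
   col_mx (p1 y)%:M (root12 y *: f0 + root22 y *: f1)).

Lemma gramA_ge0 y : 0 <= gramA y.
Proof. by rewrite le_max lexx. Qed.
Lemma gramC_ge0 y : 0 <= gramC y.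
Proof. by rewrite le_max lexx. Qed.
Lemma root_det_ge0 y : 0 <= root_det y.
Proof. exact: sqrtr_ge0. Qed.

(** What allows the lift of the section to the orthogonal group: the component of
    the section along [f0] is nonnegative. *)
Lemma root11_ge0 y : 0 <= root11 y.
Proof. by rewrite divr_ge0 ?sqrtr_ge0 // addr_ge0 ?gramA_ge0 ?root_det_ge0. Qed.

Lemma root_trace_sqr y : root_trace y ^+ 2 = gramA y + gramC y + 2 * root_det y.
Proof.
rewrite sqr_sqrtr //; have := gramA_ge0 y; have := gramC_ge0 y.
by have := root_det_ge0 y; lra.
Qed.

Lemma gram_reduced y : reduced_space R y ->
  [/\ gramA y = 1 - q1 y ^+ 2,
    gramC y = P y - p1 y ^+ 2 & gramB y = - (q1 y * p1 y)].
Proof.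
move=> [h1 /andP[h2 h3] h4].
have q2 : q1 y ^+ 2 <= 1 by nra.
have pP : p1 y ^+ 2 <= P y by have := sqr_ge0 (q1 y); nra.
have Ae : gramA y = 1 - q1 y ^+ 2 by rewrite /gramA max_r // subr_ge0.
have Ce : gramC y = P y - p1 y ^+ 2 by rewrite /gramC max_r // subr_ge0.
have Bb : `|q1 y * p1 y| <= gramA y + gramC y.
  rewrite -(@ler_pXn2r _ 2) ?nnegrE // ?addr_ge0 ?gramA_ge0 ?gramC_ge0 //.
  rewrite real_normK ?num_real // exprMn Ae Ce.
  nra.
rewrite /gramB; split=> //; move: Bb; rewrite ler_norml => /andP[b1 b2].
by rewrite min_r ?max_r //; lra.
Qed.

Lemma sphere_section_gram y (z := sphere_section y) : reduced_space R y ->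
  [/\ dot z.1 z.1 = 1, dot z.1 z.2 = 0 & dot z.2 z.2 = P y].
Proof.
move=> yR; have [Ae Ce Be] := gram_reduced yR; have [h1 /andP[h2 h3] h4] := yR.
have gE : gap y = gramA y * gramC y - gramB y ^+ 2.
  by rewrite Ae Ce Be /gap; ring.
have [||| e1 e2 e3] := @sqrt_psd2 R (gramA y) (gramB y) (gramC y).
- exact: gramA_ge0.
- exact: gramC_ge0.
- by rewrite -subr_ge0 -gE subr_ge0.
rewrite -gE -/(root_det y) -/(root_trace y) -/(root11 y) -/(root12 y) -/(root22
  y) in e1 e2 e3.
rewrite /z !dot_split /= !col_mxKu !col_mxKd !mxE eqxx !mulr1n !dotE (dotC f1
  f0) f00 f01 f11.
split.
- by rewrite -[RHS](subrK (q1 y ^+ 2)) -Ae -e1; ring.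
- by rewrite -[RHS](subrr (q1 y * p1 y)) -Be -e2; ring.
- by rewrite -[RHS](subrK (p1 y ^+ 2)) -Ce -e3; ring.
Qed.

Lemma sphere_sectionP y : reduced_space R y ->
  exists2 x : cotangent_sphere R m,
    set_val x = sphere_section y & invariants x = y.
Proof.
move=> yR; have [e1 e2 e3] := sphere_section_gram yR.
have zT : sphere_section y \in cotangent_sphere R m.
  by rewrite inE; apply/cotangent_sphereP.
exists (SigSub zT) => //; rewrite invariantsE /= e3 [RHS]pt3_eta.
by rewrite !col_mxKu !mxE eqxx !mulr1n.
Qed.

Lemma continuous_coord i : continuous (fun y => y 0 i).
Proof. exact: coord_continuous. Qed.

Lemma continuous_gramA : continuous gramA.
Proof.
apply: continuous_maxr; first exact: cst_continuous.
apply: continuous_add; first exact: cst_continuous.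
exact/continuous_opp/continuous_sqr/continuous_coord.
Qed.

Lemma continuous_gramC : continuous gramC.
Proof.
apply: continuous_maxr; first exact: cst_continuous.
apply: continuous_add; first exact: continuous_coord.
exact/continuous_opp/continuous_sqr/continuous_coord.
Qed.

Lemma continuous_gramB : continuous gramB.
Proof.
have AC : continuous (fun y => gramA y + gramC y).
  by apply: continuous_add; [exact: continuous_gramA|exact: continuous_gramC].
apply: continuous_maxr; first exact: continuous_opp.
apply: continuous_minr => //.
by apply/continuous_opp/continuous_mul; exact: continuous_coord.
Qed.

Lemma continuous_root_det : continuous root_det.
Proof. exact/continuous_sqrt/continuous_gap. Qed.

Lemma continuous_root_trace : continuous root_trace.
Proof.
apply/continuous_sqrt/continuous_add.
  by apply: continuous_add; [exact: continuous_gramA|exact: continuous_gramC].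
by apply: continuous_mul; [exact: cst_continuous|exact: continuous_root_det].
Qed.

Lemma continuous_root11 : continuous root11.
Proof.
apply: continuous_div_sqr; last 1 first.
- move=> y; rewrite root_trace_sqr; have := gramA_ge0 y; have := gramC_ge0 y.
  by have := root_det_ge0 y => *; rewrite ger0_norm; lra.
- by apply: continuous_add;
  [exact: continuous_gramA|exact: continuous_root_det].
- exact: continuous_root_trace.
Qed.

Lemma continuous_root22 : continuous root22.
Proof.
apply: continuous_div_sqr; last 1 first.
- move=> y; rewrite root_trace_sqr; have := gramA_ge0 y; have := gramC_ge0 y.
  by have := root_det_ge0 y => *; rewrite ger0_norm; lra.
- by apply: continuous_add;
  [exact: continuous_gramC|exact: continuous_root_det].
- exact: continuous_root_trace.
Qed.

Lemma continuous_root12 : continuous root12.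
Proof.
apply: continuous_div_sqr;
  [exact: continuous_gramB|exact: continuous_root_trace|].
move=> y; rewrite root_trace_sqr; have := gramA_ge0 y; have := gramC_ge0 y.
have := root_det_ge0 y => d0 c0 a0; rewrite ler_norml /gramB.
rewrite le_max ge_max ge_min; apply/andP; split; last by apply/andP; split;
  [|apply/orP; left]; lra.
by apply/orP; left; lra.
Qed.

Lemma continuous_col_mx (T : topologicalType) k (a : T -> R) (b : T ->
  'cV[R]_k) :
  continuous a -> continuous b -> continuous (fun t =>
    col_mx (a t)%:M (b t) : 'cV_(1 + k)).
Proof.
move=> ca cb; apply: continuous_mx => i j; rewrite ord1.
case: (split_ordP i) => {}i ->.
  by under eq_fun do rewrite col_mxEu ord1 mxE eqxx mulr1n.
by under eq_fun do rewrite col_mxEd; exact: continuous_entry.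
Qed.

Lemma continuous_sphere_section : continuous sphere_section.
Proof.
have c2 (a b : vec3 -> R) : continuous a -> continuous b ->
    continuous (fun y => a y *: f0 + b y *: f1).
  move=> ca cb; apply: continuous_add; apply: continuous_scale => //;
  exact: cst_continuous.
apply: continuous_pair; apply: continuous_col_mx; try exact: continuous_coord.
- by apply: c2; [exact: continuous_root11|exact: continuous_root12].
- by apply: c2; [exact: continuous_root12|exact: continuous_root22].
Qed.

End SphereSection.

(** * The stabiliser of the first axis *)

Section Stabiliser.
Variables (R : realType) (m : nat).
Implicit Types (u v : 'cV[R]_(1 + m)) (B : stab_e1 R m).

Lemma e1E : e1 R m = col_mx 1%:M 0.
Proof.
apply: vec_eq; last by rewrite col_mxKd; apply/matrixP => i j; rewrite !mxE.
by rewrite col_mxKu !mxE.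
Qed.

Lemma usubmx_e1 : usubmx (e1 R m) 0 0 = 1.
Proof. by rewrite e1E col_mxKu mxE eqxx. Qed.

Lemma dot_e1 u : dot (e1 R m) u = usubmx u 0 0.
Proof. by rewrite dot_split usubmx_e1 e1E col_mxKd dot0l addr0 mul1r. Qed.

Lemma stab_block B :
  (B : 'M[R]_(1 + m)) = block_mx 1%:M 0 0 (drsubmx (B : 'M[R]_(1 + m))).
Proof.
have h1 := eqP (stab_orthP B); have h2 := stab_e1V B; move: h1 h2.
move: (orth_mx _) => M;
  rewrite e1E -{1 2 3}(submxK M) tr_block_mx !mul_block_col.
rewrite !mulmx1 !mulmx0 !addr0 => /eq_col_mx[-> ->] /eq_col_mx[_ h].
by rewrite -[ursubmx _]trmxK h trmx0.
Qed.

Fact stab_restr_subproof B :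
  (drsubmx (B : 'M[R]_(1 + m)))^T *m drsubmx (B : 'M[R]_(1 + m)) == 1%:M.
Proof.
have := eqP (orth_mxP B); rewrite (stab_block B) tr_block_mx mulmx_block.
rewrite !trmx0 !mul0mx !add0r !block_mxKdr.
by rewrite [X in _ = X]scalar_mx_block => /eq_block_mx[_ _ _ ->].
Qed.

Definition stab_restr B : orth R m := Orth (stab_restr_subproof B).

Lemma stab_rot B u : (B : 'M[R]_(1 + m)) *m u = Defs.rot (stab_restr B) u.
Proof.
rewrite {1}(stab_block B) -{1}(vsubmxK u) mul_block_col.
by rewrite mul1mx !mul0mx addr0 add0r.
Qed.

Fact stab_ext_subproof (h : orth R m) :
  (block_mx 1%:M 0 0 (h : 'M[R]_m) : 'M[R]_(1 + m))^T *m block_mx 1%:M 0 0 (h :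
    'M[R]_m) == 1%:M.
Proof.
rewrite tr_block_mx mulmx_block !trmx0 trmx1 !mul0mx !mulmx0 mul1mx !addr0
  add0r.
by rewrite (eqP (orth_mxP h)) -scalar_mx_block.
Qed.

Fact stab_ext_fix (h : orth R m) : fix_e1 (Orth (stab_ext_subproof h)).
Proof.
apply/eqP; rewrite /= e1E mul_block_col.
by rewrite mul1mx !mulmx0 !mul0mx !addr0.
Qed.

Definition stab_ext (h : orth R m) : stab_e1 R m := StabE1 (stab_ext_fix h).

Lemma stab_extK : cancel stab_ext stab_restr.
Proof. by move=> h; apply/val_inj; rewrite /= block_mxKdr. Qed.

End Stabiliser.

(** * Recovering the angular velocity from the momentum *)

Section Legendre.
Variables (R : realType) (m : nat) (J1 J2 : R).
Hypotheses (J1_gt0 : 0 < J1) (J2_gt0 : 0 < J2).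
Local Notation n := (1 + m)%N.
Local Notation D := (veselova_space R m).
Local Notation L := (@legendre R m J1 J2).
Local Notation e1 := (e1 R m).
Implicit Types (u v q p : 'cV[R]_n) (x y : D) (A B : stab_e1 R m).

Lemma mass_tensorE u :
  mass_tensor m J1 J2 *m u = J2 *: u + ((J1 - J2) * usubmx u 0 0) *: e1.
Proof.
rewrite /mass_tensor -{1}(vsubmxK u) mul_block_col !mul_scalar_mx !mul0mx addr0
  add0r.
apply: vec_eq; rewrite ?col_mxKu ?col_mxKd.
  by rewrite mxE -[RHS]dot_e1 dotDr !dotZr !dot_e1 usubmx_e1; ring.
by rewrite e1E linearD !linearZ /= col_mxKd scaler0 addr0.
Qed.

Lemma wedgemx_mul u v w : wedgemx u v *m w = dot v w *: u - dot u w *: v.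
Proof. by rewrite /wedgemx mulmxBl !mul_outer. Qed.

Lemma wedgemx_perp q v : wedgemx q (v - dot q v *: q) = wedgemx q v.
Proof.
rewrite /wedgemx linearB linearZ /= mulmxBr mulmxBl -scalemxAr -scalemxAl.
by rewrite opprB addrA subrK.
Qed.

(** The coefficient of [v] in the momentum of [q /\ v]. *)
Definition inertia_factor q : R := 2 * J2 + (J1 - J2) * (usubmx q 0 0) ^+ 2.

(** For [a = inertia_factor q] this inverts the linear map of [momentum_wedge] on
    the vectors orthogonal to [q]: the first component of [p] is [J1 + J2] times
    that of [v], and once it is known [v] can be solved for. The divisor is a
    parameter because the section uses an expression for it that is positive on
    all of [R^3]. *)
Definition velocity (a : R) q p : 'cV[R]_n :=
  a^-1 *: (p - ((J1 - J2) * usubmx p 0 0 / (J1 + J2)) *: (e1 - usubmx q 0 0 *: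
    q)).

Lemma momentum_wedge q v : dot q q = 1 -> dot q v = 0 ->
  - (inertia J1 J2 (wedgemx q v) *m q) =
  inertia_factor q *: v + ((J1 - J2) * usubmx v 0 0) *: (e1 - usubmx q 0 0 *:
    q).
Proof.
move=> qq qv; rewrite /inertia mulmxDl -!mulmxA wedgemx_mul !mass_tensorE.
rewrite mulmxDr -!scalemxAr !wedgemx_mul (dotC v q) qq qv !(dotC _ e1) !dot_e1.
apply/matrixP => i j; rewrite /inertia_factor !mxE; ring.
Qed.

Lemma sphere_le1 q : dot q q = 1 -> (usubmx q 0 0) ^+ 2 <= 1.
Proof. by move=> <-; rewrite dot_split -expr2 lerDl dot_ge0. Qed.

Lemma inertia_factor_gt0 q : dot q q = 1 -> 0 < inertia_factor q.
Proof.
move=> /sphere_le1; have := sqr_ge0 (usubmx q 0 0); rewrite /inertia_factor.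
move: (_ ^+ 2) => s s0 s1; have := mulr_ge0 (ltW J1_gt0) s0.
have Js : J2 * s <= J2 by rewrite ger_pMr.
by have := J2_gt0; nra.
Qed.

Lemma velocity_perp a q p : dot q q = 1 -> dot q p = 0 ->
  dot q (velocity a q p) = 0.
Proof. by move=> qq qp; rewrite !dotE qp qq (dotC q) dot_e1; ring. Qed.

Lemma usubmx_e1q q : usubmx (e1 - usubmx q 0 0 *: q) 0 0 = 1 - usubmx q 0 0 ^+
  2.
Proof. by rewrite -[LHS]dot_e1 dotDr dotNr dotZr !dot_e1 usubmx_e1; ring. Qed.

Lemma usubmx_velocity q p : dot q q = 1 -> dot q p = 0 ->
  usubmx (velocity (inertia_factor q) q p) 0 0 = usubmx p 0 0 / (J1 + J2).
Proof.
move=> qq qp; have a0 := inertia_factor_gt0 qq.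
rewrite -[LHS]dot_e1 /velocity dotZr dotDr dotNr dotZr !dot_e1 usubmx_e1q.
move: a0; rewrite /inertia_factor => a0; field.
by apply/andP; split; apply: lt0r_neq0 => //; exact: addr_gt0.
Qed.

Lemma momentum_velocity q p : dot q q = 1 -> dot q p = 0 ->
  - (inertia J1 J2 (wedgemx q (velocity (inertia_factor q) q p)) *m q) = p.
Proof.
move=> qq qp; rewrite momentum_wedge ?velocity_perp // usubmx_velocity //.
by rewrite /velocity scalerA divff ?lt0r_neq0 ?inertia_factor_gt0 // scale1r
  -mulrA subrK.
Qed.

Lemma velocity_momentum q v : dot q q = 1 -> dot q v = 0 ->
  velocity (inertia_factor q) q (- (inertia J1 J2 (wedgemx q v) *m q)) = v.
Proof.
move=> qq qv; rewrite momentum_wedge // /velocity.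
set a := inertia_factor q;
  have a0 : a != 0 by rewrite lt0r_neq0 ?inertia_factor_gt0.
set w := e1 - _; set p := a *: v + _.
have -> : usubmx p 0 0 = (J1 + J2) * usubmx v 0 0.
  rewrite -[LHS]dot_e1 /p dotDr !dotZr !dot_e1 usubmx_e1q /a /inertia_factor;
    ring.
rewrite mulrCA [X in X *: w]mulrC mulKf ?lt0r_neq0 ?addr_gt0 //.
by rewrite /p mulrC addrK scalerA mulVf // scale1r.
Qed.

Lemma veselova_q x : dot ((val x).1^T *m e1) ((val x).1^T *m e1) = 1.
Proof.
have [h _ _] := set_valP x.
by rewrite (@dot_orth _ _ (orth_inv (Orth (introT eqP h)))) dot_e1 usubmx_e1.
Qed.

Lemma legendre1 x : (val (L x)).1 = (val x).1^T *m e1.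
Proof.
have [+ _ _] := set_valP x; rewrite /legendre /=.
by case: (val x) => g W /= /orth_invmx ->.
Qed.

Lemma legendre2 x : (val (L x)).2 = - (inertia J1 J2 (val x).2 *m ((val x).1^T
  *m e1)).
Proof.
have [+ _ _] := set_valP x; rewrite /legendre /=.
by case: (val x) => g W /= /orth_invmx ->.
Qed.

(** The vector [v] in [q /\ v] may be taken orthogonal to [q], and is then
    determined by the momentum. *)
Lemma legendre_velocity x (q := (val (L x)).1) (p := (val (L x)).2) :
  (val x).2 = wedgemx q (velocity (inertia_factor q) q p).
Proof.
rewrite /p /q legendre1 legendre2; have [h _ [v]] := set_valP x.
have qq := veselova_q x; rewrite (orth_invmx h).
set q' := _ *m e1 => hv.
have wq : dot q' (v - dot q' v *: q') = 0 by rewrite !dotE qq mulr1 subrr.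
by rewrite hv -(wedgemx_perp q') velocity_momentum.
Qed.

Lemma veselova_build (g : 'M[R]_n) q p :
  g^T *m g = 1%:M -> g *m q = e1 -> dot q p = 0 ->
  exists2 x : D, val x = (g, wedgemx q (velocity (inertia_factor q) q p)) &
                 val (L x) = (q, p).
Proof.
move=> hg gq qp; have qE : g^T *m e1 = q by rewrite -gq mulmxA hg mul1mx.
have zD : (g, wedgemx q (velocity (inertia_factor q) q p)) \in D.
  rewrite inE; split=> //=; last by exists (velocity (inertia_factor q) q p);
    rewrite (orth_invmx hg) qE.
  by rewrite /wedgemx linearB /= !trmx_mul !trmxK opprB.
pose x : D := SigSub zD; have qq := veselova_q x; rewrite /= qE in qq.
exists x => //; rewrite [LHS]surjective_pairing legendre1 legendre2 /= qE.
by rewrite momentum_velocity.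
Qed.

End Legendre.

(** * Orbits and orbit types of the unreduced system *)

Section VeselovaOrbits.
Variables (R : realType) (m : nat) (J1 J2 : R).
Hypotheses (J1_gt0 : 0 < J1) (J2_gt0 : 0 < J2).
Local Notation n := (1 + m)%N.
Local Notation D := (veselova_space R m).
Local Notation L := (@legendre R m J1 J2).
Local Notation e1 := (e1 R m).
Local Notation actD := (veselova_action R m).
Local Notation actT := (cotangent_action R m).
Implicit Types (x y : D) (A B : stab_e1 R m) (h : orth R m).

Lemma mass_tensor_comm B :
  mass_tensor m J1 J2 *m (B : 'M[R]_n) = (B : 'M[R]_n) *m mass_tensor m J1 J2.
Proof.
rewrite (stab_block B) /mass_tensor !mulmx_block !mul0mx !mulmx0 !addr0 !add0r.
by rewrite mulmx1 mul1mx mul_scalar_mx mul_mx_scalar.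
Qed.

Lemma veselova_act_fst A B x :
  (val (actD (A, B) x)).1 = (A : 'M[R]_n) *m (val x).1 *m (B : 'M[R]_n)^T.
Proof. by rewrite /=; case: (val x). Qed.

Lemma veselova_act_snd A B x :
  (val (actD (A, B) x)).2 = (B : 'M[R]_n) *m (val x).2 *m (B : 'M[R]_n)^T.
Proof. by rewrite /=; case: (val x). Qed.

Lemma legendre_equivariant A B x : L (actD (A,
  B) x) = actT (stab_restr B) (L x).
Proof.
apply/val_inj; rewrite [LHS]surjective_pairing [RHS]surjective_pairing.
have q' : (val (L (actD (A, B) x))).1 = (B : 'M[R]_n) *m (val (L x)).1.
  by rewrite !legendre1 veselova_act_fst !trmx_mul !trmxK -!mulmxA stab_e1V.
congr pair; first by rewrite q' stab_rot.
rewrite legendre2 -(legendre1 J1 J2) q' veselova_act_snd.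
rewrite -[RHS]/(Defs.rot (stab_restr B) (val (L x)).2) -stab_rot.
rewrite legendre2 -(legendre1 J1 J2); move: (val x).2 (val (L x)).1 => W q.
rewrite mulmxN /inertia !mulmxDl mulmxDr; congr (- (_ + _)).
  by rewrite -!mulmxA orth_mulK !mulmxA mass_tensor_comm.
by rewrite -!mulmxA (mulmxA (mass_tensor _ _ _)) mass_tensor_comm -!mulmxA
  orth_mulK.
Qed.

Lemma stab_restr1 : stab_restr (1%g : stab_e1 R m) = 1%g.
Proof. by apply/val_inj; rewrite /= [1%:M]scalar_mx_block block_mxKdr. Qed.

Lemma legendre_left A x : L (actD (A, 1%g) x) = L x.
Proof. by rewrite legendre_equivariant stab_restr1 act1g. Qed.

Lemma legendre_ext h x : L (actD (1%g, stab_ext h) x) = actT h (L x).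
Proof. by rewrite legendre_equivariant stab_extK. Qed.

Lemma attitude_orth x : (val x).1^T *m (val x).1 = 1%:M.
Proof. by have [] := set_valP x. Qed.

Lemma attitude_orthV x : (val x).1 *m (val x).1^T = 1%:M.
Proof. exact/mulmx1C/attitude_orth. Qed.

Lemma attitude_q x : (val x).1 *m (val (L x)).1 = e1.
Proof. by rewrite legendre1 mulmxA attitude_orthV mul1mx. Qed.

Lemma veselova_eq x y : (val x).1 = (val y).1 -> L x = L y -> x = y.
Proof.
move=> e eL; apply/val_inj;
  rewrite [LHS]surjective_pairing [RHS]surjective_pairing e.
by congr pair; rewrite !(legendre_velocity J1_gt0 J2_gt0) eL.
Qed.

Lemma stab_transport (g : 'M[R]_n) x :
  g^T *m g = 1%:M -> g *m (val (L x)).1 = e1 ->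
  exists A, (A : 'M[R]_n) *m (val x).1 = g.
Proof.
move=> hg gq.
have hA : (g *m (val x).1^T)^T *m (g *m (val x).1^T) == 1%:M.
  rewrite trmx_mul trmxK -mulmxA (mulmxA g^T) hg mul1mx.
  by rewrite attitude_orthV.
have hfix : fix_e1 (Orth hA) by apply/eqP;
  rewrite /= -mulmxA -(legendre1 J1 J2) gq.
by exists (StabE1 hfix); rewrite /= -mulmxA attitude_orth mulmx1.
Qed.

Lemma legendre_fiber x y : L x = L y -> exists A, actD (A, 1%g) x = y.
Proof.
move=> e; have [|A hA] := stab_transport (attitude_orth y) (x := x).
  by rewrite e attitude_q.
exists A; apply: veselova_eq; last by rewrite legendre_left.
by rewrite -hA veselova_act_fst trmx1 mulmx1.
Qed.

Lemma veselova_orbitP x y :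
  invariants (L x) = invariants (L y) <-> exists c, actD c x = y.
Proof.
rewrite cotangent_orbitP; split=> [[h e]|[[A B] <-]]; last first.
  by exists (stab_restr B); rewrite legendre_equivariant.
have [|A hA] := @legendre_fiber (actD (1%g, stab_ext h) x) y;
  first by rewrite legendre_ext.
by exists ((A, 1) * (1, stab_ext h))%g; rewrite actMg.
Qed.

Lemma veselova_isotropyP A B x :
  isotropy actD x (A, B) <->
  (A : 'M[R]_n) = (val x).1 *m B *m (val x).1^T /\
  isotropy actT (L x) (stab_restr B).
Proof.
have BB : (B : 'M[R]_n)^T *m B = 1%:M := eqP (orth_mxP B).
split=> [e|[e1 e2]].
  have {}e : actD (A, B) x = x := e.
  split; last first.
    by rewrite -[isotropy _ _ _]/(actT _ _ = _) -(legendre_equivariant A) e.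
  have := congr1 (fun z : D => (val z).1) e; rewrite veselova_act_fst => e'.
  by rewrite -{1}e' -!mulmxA orth_mulK attitude_orthV mulmx1.
change (actD (A, B) x = x); apply: veselova_eq;
  last by rewrite legendre_equivariant.
by rewrite veselova_act_fst e1 -!mulmxA (mulmxA (val x).1^T) attitude_orth
  mul1mx (mulmx1C BB) mulmx1.
Qed.

Lemma isotropy_legendre h x :
  isotropy actT (L x) h <-> exists A, isotropy actD x (A, stab_ext h).
Proof.
split=> [e|[A /veselova_isotropyP[_]]]; last by rewrite stab_extK.
have [|A hA] := @legendre_fiber (actD (1%g, stab_ext h) x) x;
  first by rewrite legendre_ext.
exists A; change (actD (A, stab_ext h) x = x); rewrite -[RHS]hA -actMg.
by rewrite -[(_ * _)%g]/(A * 1, 1 * stab_ext h)%g mulg1 mul1g.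
Qed.

(** A conjugation that matches the isotropy groups of the images in the cotangent
    bundle need not match the vectors [q]; since the isotropy group fixes both, a
    reflection that commutes with it brings one onto the other. *)
Lemma veselova_same_orbit_type x y :
  same_orbit_type actD x y <-> same_orbit_type actT (L x) (L y).
Proof.
rewrite !same_orbit_typeP; split=> [[[A B] e]|[h e]].
  exists (stab_restr B); rewrite -(legendre_equivariant A).
  by apply/seteqP; split=> k /isotropy_legendre[C hC]; apply/isotropy_legendre;
    exists C; rewrite ?e // -e.
pose x' := actD (1%g, stab_ext h) x.
have {}e : isotropy actT (L y) = isotropy actT (L x') by rewrite legendre_ext.
pose q := (val (L y)).1; pose q' := (val (L x')).1.
pose u := reflection (q' - q).
have uq : (u : 'M[R]_n) *m q' = q.
  by apply: reflection_swap; rewrite /q /q' !legendre1 !veselova_q.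
have ug : ((val y).1 *m u)^T *m ((val y).1 *m u) = 1%:M.
  by rewrite trmx_mul -mulmxA (mulmxA (val y).1^T) attitude_orth mul1mx (eqP
    (orth_mxP u)).
have [|A hA] := stab_transport ug (x := x').
  by rewrite -mulmxA uq attitude_q.
exists ((A, 1) * (1, stab_ext h))%g; rewrite actMg -/x'.
have attE : (val (actD (A, 1%g) x')).1 = (val y).1 *m u.
  by rewrite -hA veselova_act_fst trmx1 mulmx1.
have LE := legendre_left A x'.
have fixq z B : isotropy actT (L z) (stab_restr B) ->
  (B : 'M[R]_n) *m (val (L z)).1 = (val (L z)).1.
  move=> hz; rewrite stab_rot.
  exact: (congr1 (fun w : cotangent_sphere R m => (val w).1) hz).
have conjE B : isotropy actT (L y) (stab_restr B) ->
    (val y).1 *m u *m B *m ((val y).1 *m u)^T = (val y).1 *m B *m (val y).1^T.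
  move=> hB; have hB' := hB; rewrite e in hB'.
  have Bfix : (B : 'M[R]_n) *m (q' - q) = q' - q by rewrite mulmxBr !fixq.
  rewrite trmx_mul -!mulmxA; congr (_ *m _); rewrite !mulmxA; congr (_ *m _).
  by rewrite -(reflection_comm Bfix) -mulmxA (mulmx1C (eqP (orth_mxP u)))
    mulmx1.
apply/seteqP; split=> -[C B] /veselova_isotropyP[hC hB];
  apply/veselova_isotropyP.
  by rewrite attE LE -e conjE.
by move: hC hB; rewrite attE LE -e => hC hB; rewrite hC conjE.
Qed.

End VeselovaOrbits.

(** * Lifting the section to the unreduced system *)

Section VeselovaSection.
Variables (R : realType) (m : nat) (J1 J2 : R) (f0 f1 : 'cV[R]_m).
Hypotheses (J1_gt0 : 0 < J1) (J2_gt0 : 0 < J2).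
Hypotheses (f00 : dot f0 f0 = 1) (f01 : dot f0 f1 = 0) (f11 : dot f1 f1 = 1).
Local Notation vec3 := 'rV[R]_3.
Local Notation n := (1 + m)%N.
Implicit Types (y : vec3).

(** The antipode of [pole] is the point of the sphere that the section avoids. *)
Definition pole : 'cV[R]_n := col_mx 0 f0.

(** Over the reduced space the second factor is the reflection that maps [q] to
    [- pole]; the first one maps [- pole] to [e1]. The reflection across
    [q + pole] is continuous in [q] away from [- pole]; its usual factor
    [2 / |q + pole|^2] is written [1 / (1 + root11 y)], which makes sense on all
    of [R^3]. *)
Definition attitude_section y : 'M[R]_n :=
  let w := (sphere_section f0 f1 y).1 + pole in
  reflection_mx (- pole - e1 R m) *m (1%:M - (1 + root11 y)^-1 *: (w *m w^T)).

Definition veselova_section y : 'M[R]_n * 'M[R]_n :=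
  let z := sphere_section f0 f1 y in
  let a := J2 * (1 + gramA y) + J1 * (1 - gramA y) in
  (attitude_section y, wedgemx z.1 (velocity J1 J2 a z.1 z.2)).

Lemma dot_pole : dot pole pole = 1.
Proof. by rewrite dot_split /pole !col_mxKu !col_mxKd f00 !mxE mulr0 add0r. Qed.

Lemma dot_section_pole y : dot (sphere_section f0 f1 y).1 pole = root11 y.
Proof.
rewrite dot_split /pole /= !col_mxKu !col_mxKd !dotE f00 (dotC f1) f01 !mxE.
by rewrite !mulr0 addr0 add0r mulr1.
Qed.

Lemma attitude_sectionE y : reduced_space R y ->
  attitude_section y = (reflection_mx (- pole - e1 R m) : 'M[R]_n) *m
    reflection_mx ((sphere_section f0 f1 y).1 - - pole).
Proof.
move=> yR; rewrite /attitude_section opprK; congr (_ *m _).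
rewrite /reflection_mx; congr (_ - _ *: _).
have [qq _ _] := sphere_section_gram f00 f01 f11 yR.
rewrite !dotDl !dotDr qq dot_pole (dotC pole) dot_section_pole.
rewrite (_ : 1 + _ + _ = 2 * (1 + root11 y)); last by ring.
by rewrite invfM mulVKf // pnatr_eq0.
Qed.

Lemma attitude_section_orth y : reduced_space R y ->
  (attitude_section y)^T *m attitude_section y = 1%:M /\
  attitude_section y *m (sphere_section f0 f1 y).1 = e1 R m.
Proof.
move=> yR; rewrite attitude_sectionE //; split.
  exact: (eqP (orth_mxP (reflection (- pole - e1 R m) *
                         reflection ((sphere_section f0 f1 y).1 - - pole))%g)).
have [qq _ _] := sphere_section_gram f00 f01 f11 yR.
rewrite -mulmxA reflection_swap ?reflection_swap //.
  by rewrite dotNl dotNr opprK dot_pole dot_e1 usubmx_e1.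
by rewrite dotNl dotNr opprK dot_pole.
Qed.

Lemma veselova_sectionP y : reduced_space R y ->
  exists2 x : veselova_space R m, set_val x = veselova_section y &
    invariants (legendre J1 J2 x) = y.
Proof.
move=> yR; have [hg gq] := attitude_section_orth yR.
have [qq qp pp] := sphere_section_gram f00 f01 f11 yR.
have [x xE LE] := veselova_build J1_gt0 J2_gt0 hg gq qp.
have [z zE zy] := sphere_sectionP f00 f01 f11 yR.
exists x; last first.
  by rewrite -[RHS]zy; congr invariants; apply/val_inj;
    rewrite LE -surjective_pairing -zE.
have aE : inertia_factor J1 J2 (sphere_section f0 f1 y).1 =
    J2 * (1 + gramA y) + J1 * (1 - gramA y).
  have [Ae _ _] := gram_reduced yR.
  rewrite /inertia_factor Ae /sphere_section /fst col_mxKu mxE eqxx mulr1n;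
    ring.
by rewrite -[LHS]/(val x) xE aE.
Qed.

Lemma continuous_veselova_section : continuous veselova_section.
Proof.
have cs := @continuous_sphere_section R m f0 f1.
have cq := continuous_fst_comp cs; have cp := continuous_snd_comp cs.
have cA := @continuous_gramA R.
have cu (f : vec3 -> 'cV[R]_n) :
    continuous f -> continuous (fun y => usubmx (f y) 0 0).
  by move=> cf; under eq_fun do rewrite mxE; exact: continuous_entry.
have cw : continuous (fun y => (sphere_section f0 f1 y).1 + pole).
  by apply: continuous_add; [exact: cq|exact: cst_continuous].
have c1 (f : vec3 -> R) : continuous f -> continuous (fun y => 1 + f y).
  by move=> cf; apply: continuous_add; [exact: cst_continuous|exact: cf].
have ck (k : R) (f : vec3 -> R) : continuous f -> continuous (fun y => k * f y).
  by move=> cf; apply: continuous_mul; [exact: cst_continuous|exact: cf].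
have ca : continuous attitude_section.
  apply: continuous_mulmx; first exact: cst_continuous.
  apply: continuous_add; first exact: cst_continuous.
  apply/continuous_opp/continuous_scale.
    apply: continuous_inv => [y|]; last exact/c1/continuous_root11.
    by rewrite lt0r_neq0 // ltr_pwDl ?root11_ge0.
  by apply: continuous_mulmx; [exact: cw|exact: continuous_trmx cw].
have cv : continuous (fun y =>
  velocity J1 J2 (J2 * (1 + gramA y) + J1 * (1 - gramA y))
    (sphere_section f0 f1 y).1 (sphere_section f0 f1 y).2).
  apply: continuous_scale.
    apply: continuous_inv => [y|].
      have A0 := gramA_ge0 y.
      have A1 : gramA y <= 1 by rewrite /gramA ge_max ler01 gerBl sqr_ge0.
      by apply: lt0r_neq0; have := J1_gt0; have := J2_gt0; nra.
    by apply: continuous_add; apply: ck; apply: c1; [|apply: continuous_opp].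
  apply: continuous_add; first exact: cp.
  apply/continuous_opp/continuous_scale.
    by apply: continuous_mul; [exact: ck _ _ (cu _ cp)|exact: cst_continuous].
  apply: continuous_add; first exact: cst_continuous.
  by apply/continuous_opp/continuous_scale; [exact: cu _ cq|exact: cq].
apply: continuous_pair; first exact: ca.
apply: continuous_add; last apply: continuous_opp.
  by apply: continuous_mulmx; [exact: cq|exact: continuous_trmx cv].
by apply: continuous_mulmx; [exact: cv|exact: continuous_trmx cq].
Qed.

Lemma continuous_legendre_invariants :
  continuous (fun x : veselova_space R m => invariants (legendre J1 J2 x)).
Proof.
pose q (x : veselova_space R m) : 'cV[R]_n := (set_val x).1^T *m e1 R m.
pose p (x : veselova_space R m) : 'cV[R]_n := - (inertia J1 J2 (set_val x).2 *m
  q x).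
rewrite (_ : (fun _ => _) = fun x =>
  pt3 (q x (lshift m 0) 0) (p x (lshift m 0) 0) (dot (p x) (p x))); last first.
  by apply/funext => x; rewrite invariantsE legendre1 legendre2 !mxE.
have cq : continuous q.
  apply: continuous_mulmx; last exact: cst_continuous.
  exact: continuous_trmx (continuous_fst_comp (@continuous_set_val _ _)).
have cW : continuous (fun x : veselova_space R m => (set_val x).2).
  exact: continuous_snd_comp (@continuous_set_val _ _).
have cp : continuous p.
  apply: continuous_opp; apply: continuous_mulmx; last exact: cq.
  by apply: continuous_add; apply: continuous_mulmx;
    (exact: cW || exact: cst_continuous).
apply: continuous_pt3; [exact: continuous_entry cq|exact: continuous_entry cp|].
by apply: continuous_entry; apply: continuous_mulmx;
  [exact: continuous_trmx cp|exact: cp].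
Qed.

End VeselovaSection.

(** * The two orbit spaces *)

(** Applied to both spaces, this shows that they have the same images of strata:
    the right-hand side depends neither on the space nor on the action. *)
Lemma orbit_type_strata_image (R : realType) (G : groupType)
    (X : topologicalType) (a : action G X) (f : X -> 'rV[R]_3)
    (phi : orbit_space a -> 'rV[R]_3) :
  (forall x, phi (orbit_proj a x) = f x) -> range f = reduced_space R ->
  (forall x y,
     same_orbit_type a x y <-> reduced_rank (f y) = reduced_rank (f x)) ->
  [set phi @` S | S in orbit_type_strata a] =
  [set @stratum R k | k in [set k | (k < 3)%N]].
Proof.
move=> phiE rf sotP.
have fR x : reduced_space R (f x) by rewrite -rf; exists x.
have fS y : reduced_space R y -> exists x, f x = y by rewrite -rf => -[x _ <-];
  exists x.
have E x : phi @` (orbit_proj a @` [set y | same_orbit_type a x y]) =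
    @stratum R (reduced_rank (f x)).
  apply/seteqP; split=> [_ [_ [y /= /sotP yx <-] <-]|y [yR yx]];
    first by rewrite phiE.
  have [z fz] := fS _ yR; exists (orbit_proj a z); last by rewrite phiE.
  by exists z => //=; apply/sotP; rewrite fz.
apply/seteqP; split=> [_ [_ [x _ <-] <-]|_ [k k3 <-]].
  by rewrite E; exists (reduced_rank (f x)) => //=; exact: reduced_rank_lt3.
have [y [yR <-]] := @stratum_nonempty R _ k3; have [x <-] := fS _ yR.
by exists (orbit_proj a @` [set y | same_orbit_type a x y]);
  [exists x|rewrite E].
Qed.

Theorem proposition4p1 (R : realType) (m : nat) (J1 J2 : R) :
  (3 <= 1 + m)%N -> 0 < J1 -> 0 < J2 -> J1 != J2 ->
  exists (phi : orbit_space (cotangent_action R m) -> 'rV[R]_3)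
         (psi : orbit_space (veselova_action R m) -> 'rV[R]_3),
    [/\ (forall x, phi (orbit_proj _ x) = invariants x) /\
        homeomorphism_onto phi (reduced_space R),
        (forall y, psi (orbit_proj _ y) = invariants (legendre J1 J2 y)) /\
        homeomorphism_onto psi (reduced_space R),
        semialgebraic (reduced_space R),
        stratification (reduced_space R)
          [set phi @` S | S in orbit_type_strata (cotangent_action R m)] &
        [set psi @` S | S in orbit_type_strata (veselova_action R m)] =
        [set phi @` S | S in orbit_type_strata (cotangent_action R m)]].
Proof.
move=> m2 J1_gt0 J2_gt0 _.
have [f0 [f1 [f00 f01 f11]]] : exists f0 f1 : 'cV[R]_m,
    [/\ dot f0 f0 = 1, dot f0 f1 = 0 & dot f1 f1 = 1].
  case: m m2 => [|[|k]] // _; exists (delta_mx 0 0), (delta_mx 1 0).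
  by rewrite /dot !trmx_delta !mul_delta_mx_cond !mxE.
have sP := sphere_sectionP f00 f01 f11.
have vP := veselova_sectionP J1_gt0 J2_gt0 f00 f01 f11.
have [phi [phiE phi_homeo]] := homeomorphism_of_section
  (@continuous_invariants R m) (@cotangent_orbitP R m) (@invariants_reduced R m)
  (@continuous_sphere_section R m f0 f1) sP.
have [psi [psiE psi_homeo]] := homeomorphism_of_section
  (@continuous_legendre_invariants R m J1 J2) (veselova_orbitP J1_gt0 J2_gt0)
  (fun x => invariants_reduced (legendre J1 J2 x))
  (@continuous_veselova_section R m J1 J2 f0 f1 J1_gt0 J2_gt0) vP.
have phi_range : range (@invariants R m) = reduced_space R.
  apply/seteqP; split=> [_ [x _ <-]|y /sP[x _ <-]]; last by exists x.
  exact: invariants_reduced.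
have psi_range : range (fun x : veselova_space R m =>
  invariants (legendre J1 J2 x)) =
    reduced_space R.
  apply/seteqP; split=> [_ [x _ <-]|y /vP[x _ <-]]; last by exists x.
  exact: invariants_reduced.
have phi_strata :=
  orbit_type_strata_image phiE phi_range (@cotangent_same_orbit_type R m).
have psi_strata := orbit_type_strata_image psiE psi_range _.
exists phi, psi; split=> //.
- exact: reduced_space_semialgebraic.
- by rewrite phi_strata; exact: reduced_space_stratification.
- rewrite phi_strata psi_strata // => x y.
  by rewrite (veselova_same_orbit_type J1_gt0 J2_gt0) cotangent_same_orbit_type.
Qed.
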